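(* Let $R$ be a commutative ring with a unit element, $\operatorname{char}R=\ell$, where either $\ell$ is an odd natural number or $\ell=0$, and let $G_R$ be the Grassmann algebra over $R$. Then for every $n\in\mathbb N$ there exists a chain of $\mathbb ZS_n$-submodules in $\frac{P_n(\mathbb Z)}{P_n(\mathbb Z)\cap\operatorname{Id}(G_R,\mathbb Z)}$ with factors $S(n-k,1^k)/\ell S(n-k,1^k)$ for each $0\leqslant k\leqslant n-1$ (each factor occurs exactly once).
   Context: $\mathbb N=\{1,2,\dots\}$. $\operatorname{char}R$ is the least $n\in\mathbb N$ with $n1_R=0$, or $0$ if there is none. The Grassmann algebra $G_R$ is the (associative) $R$-algebra with unit generated by the countable set of generators $e_i$, $i\in\mathbb N$, subject to the anti-commutative relations $e_ie_j=-e_je_i$, $i,j\in\mathbb N$. $\mathbb Z\langle X\rangle$ is the free associative ring without $1$ on $X=\{x_1,x_2,\dots\}$. For a ring $A$, $\operatorname{Id}(A,\mathbb Z)\subseteq\mathbb Z\langle X\rangle$ is the set of $f$ with $f(a_1,\dots,a_n)=0$ for all $a_i\in A$. $P_n(\mathbb Z)$ is the additive subgroup of $\mathbb Z\langle X\rangle$ generated by $x_{\sigma(1)}\cdots x_{\sigma(n)}$, $\sigma\in S_n$; $S_n$ acts by permuting the variables. $(n-k,1^k)$ is the partition of $n$ with first part $n-k$ followed by $k$ parts equal to $1$. For a Young tableau $T_\lambda$ of shape $\lambda\vdash n$ with row stabilizer $R_{T_\lambda}$ and column stabilizer $C_{T_\lambda}$, let $a_{T_\lambda}=\sum_{\pi\in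 R_{T_\lambda}}\pi$, $b_{T_\lambda}=\sum_{\sigma\in C_{T_\lambda}}(\operatorname{sign}\sigma)\sigma$; the integral Specht module is $S(\lambda):=(\mathbb ZS_n)b_{T_\lambda}a_{T_\lambda}$, which up to isomorphism does not depend on $T_\lambda$. *)

(* Defs.v *)
From HB Require Import structures.
From mathcomp Require Import all_boot all_fingroup all_algebra.
From mathcomp Require Import generic_quotient ring_quotient.
From mathcomp Require Import finmap boolp.
From mathcomp.multinomials Require Import monalg.

Set Implicit Arguments.
Unset Strict Implicit.
Unset Printing Implicit Defensive.

Import GRing.Theory.
Local Open Scope ring_scope.
Local Open Scope quotient_scope.

Section MalgMap.
Variables (G : zmodType) (K L : choiceType).
Implicit Types (f g : {malg G[K]}) (h : K -> L).

Definition malg_map h f : {malg G[L]} := \sum_(k <- msupp f) << f@_k *g h k >>.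

Lemma malg_mapw h f (d : {fset K}) : (msupp f `<=` d)%fset ->
  malg_map h f = \sum_(k <- d) << f@_k *g h k >>.
Proof.
move=> le_d; apply/big_fset_incl => // k _ /mcoeff_outdom ->.
by rewrite monalgU0.
Qed.

Lemma malg_mapD h : {morph malg_map h : f g / f + g}.
Proof.
move=> f g; rewrite (malg_mapw _ (msuppD_le f g)).
rewrite (malg_mapw _ (fsubsetUl (msupp f) (msupp g))).
rewrite (malg_mapw _ (fsubsetUr (msupp f) (msupp g))) -big_split /=.
by apply/eq_bigr => k _; rewrite mcoeffD monalgUD.
Qed.

Lemma malg_map_zmod h : zmod_morphism (malg_map h).
Proof.
move=> f g; apply/(canRL (addrK _)).
by rewrite -malg_mapD subrK.
Qed.
HB.instance Definition _ h :=
  GRing.isZmodMorphism.Build {malg G[K]} {malg G[L]} (malg_map h)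
    (malg_map_zmod h).

Lemma malg_mapU h c k : malg_map h << c *g k >> = << c *g h k >>.
Proof. by rewrite (malg_mapw _ msuppU_le) big_seq_fset1 mcoeffUU. Qed.
End MalgMap.

Lemma malg_map_id (G : zmodType) (K : choiceType) (h : K -> K)
  (f : {malg G[K]}) : h =1 id -> malg_map h f = f.
Proof.
by move=> hE; rewrite [RHS]monalgE; apply: eq_bigr => k _; rewrite hE.
Qed.

Lemma malg_map_comp (G : zmodType) (K L M : choiceType) (h : K -> L)
  (h' : L -> M) (f : {malg G[K]}) :
  malg_map h' (malg_map h f) = malg_map (h' \o h) f.
Proof.
rewrite [malg_map h f]/malg_map raddf_sum /=.
by apply: eq_bigr => k _; rewrite malg_mapU.
Qed.

(* Unlike {malg R[M]} with its own ring structure, R may be the zero ring and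
   M any monoid (not only one without nontrivial units). *)
Definition monalg (R : pzRingType) (M : monoidType) : Type := {malg R[M]}.

Section MonoidAlgebra.
Variables (R : pzRingType) (M : monoidType).
Implicit Types f g : {malg R[M]}.

HB.instance Definition _ := GRing.Zmodule.copy (monalg R M) {malg R[M]}.

Definition ma_one : {malg R[M]} := << (1 : R) *g (1%g : M) >>.
Definition ma_mul f g : {malg R[M]} :=
  \sum_(k <- msupp f) \sum_(l <- msupp g) << f@_k * g@_l *g (k * l)%g >>.

Lemma ma_mulw (d e : {fset M}) f g :
  (msupp f `<=` d)%fset -> (msupp g `<=` e)%fset ->
  ma_mul f g = \sum_(k <- d) \sum_(l <- e) << f@_k * g@_l *g (k * l)%g >>.
Proof.
move=> le_d le_e; rewrite /ma_mul (big_fset_incl _ le_d) /=.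
  apply/eq_bigr=> k1 _; apply/big_fset_incl => // k _ /mcoeff_outdom ->.
  by rewrite mulr0 monalgU0.
move=> k _ /mcoeff_outdom fk.
by rewrite big1 => // l _; rewrite fk mul0r monalgU0.
Qed.

Lemma ma_mulDl : left_distributive ma_mul +%R.
Proof.
move=> f g h; rewrite (ma_mulw (msuppD_le f g) (fsubset_refl (msupp h))).
rewrite (ma_mulw (fsubsetUl (msupp f) (msupp g)) (fsubset_refl (msupp h))).
rewrite (ma_mulw (fsubsetUr (msupp f) (msupp g)) (fsubset_refl (msupp h))).
rewrite -big_split /=; apply/eq_bigr=> k _.
rewrite -big_split /=; apply/eq_bigr=> l _.
by rewrite mcoeffD mulrDl monalgUD.
Qed.

Lemma ma_mulDr : right_distributive ma_mul +%R.
Proof.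
move=> h f g; rewrite (ma_mulw (fsubset_refl (msupp h)) (msuppD_le f g)).
rewrite (ma_mulw (fsubset_refl (msupp h)) (fsubsetUl (msupp f) (msupp g))).
rewrite (ma_mulw (fsubset_refl (msupp h)) (fsubsetUr (msupp f) (msupp g))).
rewrite -big_split /=; apply/eq_bigr=> k _.
rewrite -big_split /=; apply/eq_bigr=> l _.
by rewrite mcoeffD mulrDr monalgUD.
Qed.

Lemma ma_mulUU a b k l :
  ma_mul << a *g k >> << b *g l >> = << a * b *g (k * l)%g >>.
Proof. by rewrite (ma_mulw msuppU_le msuppU_le) !big_seq_fset1 !mcoeffUU. Qed.

Lemma ma_mul0g : left_zero 0 ma_mul.
Proof. by move=> f; rewrite /ma_mul msupp0 big_seq_fset0. Qed.

Lemma ma_mulg0 : right_zero 0 ma_mul.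
Proof.
by move=> f; rewrite /ma_mul big1 // => k _; rewrite msupp0 big_seq_fset0.
Qed.

Lemma ma_mul_suml I (r : seq I) (F : I -> {malg R[M]}) g :
  ma_mul (\sum_(i <- r) F i) g = \sum_(i <- r) ma_mul (F i) g.
Proof.
exact: (big_morph (ma_mul^~ g) (fun _ _ => ma_mulDl _ _ _) (ma_mul0g _)).
Qed.

Lemma ma_mul_sumr I (r : seq I) (F : I -> {malg R[M]}) g :
  ma_mul g (\sum_(i <- r) F i) = \sum_(i <- r) ma_mul g (F i).
Proof.
exact: (big_morph (ma_mul g) (fun _ _ => ma_mulDr _ _ _) (ma_mulg0 _)).
Qed.

Lemma ma_mul1 : left_id ma_one ma_mul.
Proof.
move=> f; rewrite [X in ma_mul _ X]monalgE ma_mul_sumr [RHS]monalgE.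
by apply: eq_bigr => k _; rewrite ma_mulUU mul1r mul1g.
Qed.

Lemma ma_mulr1 : right_id ma_one ma_mul.
Proof.
move=> f; rewrite [X in ma_mul X _]monalgE ma_mul_suml [RHS]monalgE.
by apply: eq_bigr => k _; rewrite ma_mulUU mulr1 mulg1.
Qed.

Lemma ma_mulA : associative ma_mul.
Proof.
move=> f g h; rewrite [f]monalgE !ma_mul_suml; apply: eq_bigr => k _.
rewrite [g]monalgE !(ma_mul_suml, ma_mul_sumr); apply: eq_bigr => l _.
rewrite [h]monalgE !ma_mul_sumr; apply: eq_bigr => m _.
by rewrite !ma_mulUU mulrA mulgA.
Qed.

HB.instance Definition _ := GRing.Zmodule_isPzRing.Build (monalg R M)
  ma_mulA ma_mul1 ma_mulr1 ma_mulDl ma_mulDr.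
End MonoidAlgebra.

Definition word : Type := seq nat.
HB.instance Definition _ := Choice.copy word (seq nat).
HB.instance Definition _ :=
  @isMonoid.Build word (@cat nat) [::] (@catA nat) (@cat0s nat) (@cats0 nat).

(* Generators and variables are numbered from 0. *)
Definition free_alg (R : pzRingType) := monalg R word.
Definition free_gen (R : pzRingType) (i : nat) : free_alg R :=
  << (1 : R) *g ([:: i] : word) >>.

Definition is_two_sided_ideal (A : pzRingType) (I : A -> Prop) : Prop :=
  [/\ I 0, forall x y, I x -> I y -> I (x - y)
    & forall a x b, I x -> I (a * x * b)].

Definition ideal_gen (A : pzRingType) (S : A -> Prop) : {pred A} :=
  fun x => `[< forall I : A -> Prop,
    is_two_sided_ideal I -> (forall y, S y -> I y) -> I x >].

Section QuotientRing.
Variables (A : pzRingType) (S : A -> Prop).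

Lemma ideal_gen_zmod : zmod_closed (ideal_gen S).
Proof.
split=> [|x y /asboolP Jx /asboolP Jy]; apply/asboolP => I idI SI.
  by case: idI.
by case: (idI) => _ IB _; apply: IB; [apply: Jx | apply: Jy].
Qed.

Lemma ideal_genM a x b : x \in ideal_gen S -> a * x * b \in ideal_gen S.
Proof.
move=> /asboolP Jx; apply/asboolP => I idI SI.
by case: (idI) => _ _ IM; apply: IM; apply: Jx.
Qed.

HB.instance Definition _ := GRing.isZmodClosed.Build A (ideal_gen S)
  ideal_gen_zmod.

Definition quotring : Type := Quotient.quot (ideal_gen S : zmodClosed A).
HB.instance Definition _ := GRing.Zmodule.on quotring.
HB.instance Definition _ :=
  EqQuotient.copy quotring (Quotient.quot (ideal_gen S : zmodClosed A)).

Definition qr_one : quotring := \pi_quotring 1.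
Definition qr_mul (x y : quotring) : quotring := \pi_quotring (repr x * repr y).

Lemma qr_pi_eq (x y : A) :
  x - y \in ideal_gen S -> \pi_quotring x = \pi_quotring y.
Proof.
move=> xy; apply/eqP.
by rewrite -(Quotient.idealrBE (ideal_gen S : zmodClosed A)).
Qed.

Lemma qr_reprB (x : A) : repr (\pi_quotring x) - x \in ideal_gen S.
Proof.
rewrite (Quotient.idealrBE (ideal_gen S : zmodClosed A)).
by apply/eqP; exact: (@reprK _ quotring).
Qed.

Lemma qr_piD (x y : A) :
  \pi_quotring (x + y) = \pi_quotring x + \pi_quotring y.
Proof. exact: (Quotient.pi_add (ideal_gen S : zmodClosed A)). Qed.

Lemma qr_piM (x y : A) :
  \pi_quotring (x * y) = qr_mul (\pi_quotring x) (\pi_quotring y).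
Proof.
apply/esym/qr_pi_eq; set x' := repr _; set y' := repr _.
have -> : x' * y' - x * y = 1 * (x' - x) * y' + x * (y' - y) * 1.
  by rewrite mul1r mulr1 mulrBl mulrBr addrA subrK.
by apply: rpredD; apply/ideal_genM/qr_reprB.
Qed.

Lemma qr_surj (x : quotring) : exists a, x = \pi_quotring a.
Proof. by exists (repr x); rewrite reprK. Qed.

Lemma qr_mulA : associative qr_mul.
Proof.
move=> x y z; have [a ->] := qr_surj x; have [b ->] := qr_surj y.
by have [c ->] := qr_surj z; rewrite -!qr_piM mulrA.
Qed.
Lemma qr_mul1 : left_id qr_one qr_mul.
Proof. by move=> x; have [a ->] := qr_surj x; rewrite -qr_piM mul1r. Qed.
Lemma qr_mulr1 : right_id qr_one qr_mul.
Proof. by move=> x; have [a ->] := qr_surj x; rewrite -qr_piM mulr1. Qed.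
Lemma qr_mulDl : left_distributive qr_mul +%R.
Proof.
move=> x y z; have [a ->] := qr_surj x; have [b ->] := qr_surj y.
by have [c ->] := qr_surj z; rewrite -qr_piD -!qr_piM -qr_piD mulrDl.
Qed.
Lemma qr_mulDr : right_distributive qr_mul +%R.
Proof.
move=> x y z; have [a ->] := qr_surj x; have [b ->] := qr_surj y.
by have [c ->] := qr_surj z; rewrite -qr_piD -!qr_piM -qr_piD mulrDr.
Qed.

HB.instance Definition _ := GRing.Zmodule_isPzRing.Build quotring
  qr_mulA qr_mul1 qr_mulr1 qr_mulDl qr_mulDr.
End QuotientRing.

(* i = j is allowed, so that 2 e_i^2 = 0 but e_i^2 = 0 is not imposed.  Only
   the underlying ring is recorded: the ideal is stable under the central
   scalars of the free algebra, so this is also the R-algebra presentation. *)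
Definition grassmann_rel (R : comPzRingType) (x : free_alg R) : Prop :=
  exists i j : nat,
    x = free_gen R i * free_gen R j + free_gen R j * free_gen R i.

Definition grassmann (R : comPzRingType) : pzRingType :=
  quotring (@grassmann_rel R).

(* {malg int[word]} is the additive group of the free unital ring on x_1, x_2,
   ...; the free ring without 1 is its subset of elements with zero constant
   term (see [is_identity]). *)
Definition ZX := {malg int[word]}.
HB.instance Definition _ := GRing.Zmodule.copy ZX {malg int[word]}.

Definition eval_free (A : pzRingType) (a : nat -> A) (f : ZX) : A :=
  \sum_(w <- msupp f) (\prod_(i <- w) a i) *~ f@_w.

Definition is_identity (A : pzRingType) (f : ZX) : Prop :=
  f@_([::] : word) = 0 /\ forall a : nat -> A, eval_free a f = 0.

(* The group ring of S_n for the product s o t : i |-> s (t i); MathComp's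
   (t * s)%g is s o t, so the terms below are the pairs with s o t = u. *)
Definition ZS (n : nat) : Type := {ffun 'S_n -> int}.
HB.instance Definition _ n := GRing.Zmodule.copy (ZS n) {ffun 'S_n -> int}.

Section GroupRing.
Variable n : nat.
Implicit Types (a b c : ZS n) (s t u : 'S_n).

Definition zs_one : ZS n := [ffun s => (s == 1%g)%:R].
Definition zs_mul a b : ZS n :=
  [ffun u => \sum_(s : 'S_n) a s * b (u * s^-1)%g].

Lemma zs_mulA : associative zs_mul.
Proof.
move=> a b c; apply/ffunP=> u; rewrite !ffunE.
under eq_bigr => s _ do rewrite ffunE mulr_sumr.
under [RHS]eq_bigr => s _ do rewrite ffunE mulr_suml.
rewrite [RHS]exchange_big /=; apply: eq_bigr => s _.
rewrite [RHS](reindex_inj (mulIg s)) /=; apply: eq_bigr => t _.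
by rewrite mulgK invMg mulrA mulgA.
Qed.

Lemma zs_mul1 : left_id zs_one zs_mul.
Proof.
move=> a; apply/ffunP=> u; rewrite ffunE (bigD1 1%g) //= big1 ?addr0.
  by rewrite ffunE eqxx mul1r invg1 mulg1.
by move=> s /negPf s1; rewrite ffunE s1 mul0r.
Qed.

Lemma zs_mulr1 : right_id zs_one zs_mul.
Proof.
move=> a; apply/ffunP=> u; rewrite ffunE (bigD1 u) //= big1 ?addr0.
  by rewrite ffunE mulgV eqxx mulr1.
move=> s su; rewrite ffunE -eq_mulgV1 eq_sym (negPf su) mulr0 //.
Qed.

Lemma zs_mulDl : left_distributive zs_mul +%R.
Proof.
move=> a b c; apply/ffunP=> u; rewrite !ffunE -big_split /=.
by apply: eq_bigr => s _; rewrite ffunE mulrDl.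
Qed.

Lemma zs_mulDr : right_distributive zs_mul +%R.
Proof.
move=> a b c; apply/ffunP=> u; rewrite !ffunE -big_split /=.
by apply: eq_bigr => s _; rewrite ffunE mulrDr.
Qed.

HB.instance Definition _ := GRing.Zmodule_isPzRing.Build (ZS n)
  zs_mulA zs_mul1 zs_mulr1 zs_mulDl zs_mulDr.
End GroupRing.

(* S_n permutes the first n variables and fixes the others. *)
Definition perm_var (n : nat) (s : 'S_n) (i : nat) : nat :=
  if insub i is Some j then val (s (j : 'I_n)) else i.

Definition perm_word (n : nat) (s : 'S_n) (w : word) : word :=
  map (perm_var s) w.

Definition permZX (n : nat) : Type := ZX.

Section PermAction.
Variable n : nat.
HB.instance Definition _ := GRing.Zmodule.copy (permZX n) ZX.
Implicit Types (s t : 'S_n) (f g : ZX) (a b : ZS n).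

Lemma perm_word1 : perm_word (1%g : 'S_n) =1 id.
Proof.
move=> w; rewrite /perm_word -[RHS]map_id; apply: eq_map => i.
by rewrite /perm_var; case: insubP => // j _ <-; rewrite perm1.
Qed.

Lemma perm_wordM s t : perm_word s \o perm_word t =1 perm_word (t * s)%g.
Proof.
move=> w; rewrite /perm_word /= -map_comp; apply: eq_map => i /=.
rewrite /perm_var; case: (insubP _ i) => [j _ _|ni].
  by rewrite valK permM.
by rewrite insubN.
Qed.

Definition perm_act s f : ZX := malg_map (perm_word s) f.
HB.instance Definition _ s := GRing.isZmodMorphism.Build ZX ZX (perm_act s)
  (malg_map_zmod (perm_word s)).

Lemma perm_act1 f : perm_act 1%g f = f.
Proof. exact: malg_map_id perm_word1. Qed.

Lemma perm_actM s t f : perm_act s (perm_act t f) = perm_act (t * s)%g f.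
Proof.
rewrite /perm_act malg_map_comp; apply: eq_bigr => w _.
by rewrite perm_wordM.
Qed.

Definition ZX_scale a f : ZX := \sum_(s : 'S_n) perm_act s f *~ a s.

Lemma ZX_scaleDr a : {morph ZX_scale a : f g / f + g}.
Proof.
move=> f g; rewrite /ZX_scale -big_split /=; apply: eq_bigr => s _.
by rewrite raddfD mulrzDl.
Qed.

Lemma ZX_scaleDl f : {morph ZX_scale^~ f : a b / a + b}.
Proof.
move=> a b; rewrite /ZX_scale -big_split /=; apply: eq_bigr => s _.
by rewrite ffunE mulrzDr.
Qed.

Lemma ZX_scaleA a b f : ZX_scale a (ZX_scale b f) = ZX_scale (zs_mul a b) f.
Proof.
rewrite /ZX_scale; under [RHS]eq_bigr => u _ do rewrite ffunE mulrz_sumr.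
rewrite [RHS]exchange_big /=; apply: eq_bigr => s _.
rewrite raddf_sum /= mulrz_suml [RHS](reindex_inj (mulIg s)) /=.
by apply: eq_bigr => t _; rewrite mulgK raddfMz /= perm_actM mulrC mulrzA.
Qed.

Lemma ZX_scale1 : left_id (zs_one n) ZX_scale.
Proof.
move=> f; rewrite /ZX_scale (bigD1 1%g) //= big1 ?addr0.
  by rewrite ffunE eqxx perm_act1.
by move=> s /negPf s1; rewrite ffunE s1.
Qed.

HB.instance Definition _ := GRing.Zmodule_isLmodule.Build (ZS n) (permZX n)
  ZX_scaleA ZX_scale1 ZX_scaleDr ZX_scaleDl.
End PermAction.

(* x_{s(1)} ... x_{s(n)} *)
Definition mono_word (n : nat) (s : 'S_n) : word :=
  [seq val (s i) | i <- enum 'I_n].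

(* P_n(Z) and Id(A, Z), as subsets of the Z S_n-module [permZX n]. *)
Definition Pn (n : nat) : {pred permZX n} :=
  fun f => `[< exists c : 'S_n -> int,
    f = \sum_(s : 'S_n) << c s *g mono_word s >> >].

Definition Id (A : pzRingType) (n : nat) : {pred permZX n} :=
  fun f => `[< is_identity A f >].

Arguments Pn : clear implicits.
Arguments Id : clear implicits.

Section PnIdSubmodules.
Variables (A : pzRingType) (n : nat).

Lemma subsemimod_from_act (P : {pred permZX n}) : zmod_closed P ->
  (forall (s : 'S_n) f, f \in P -> perm_act s f \in P) -> subsemimod_closed P.
Proof.
move=> zP actP; pose zS := GRing.isZmodClosed.Build (permZX n) P zP.
pose P' : zmodClosed (permZX n) := HB.pack P zS.
split; first by split; [exact: (rpred0 P') | exact: (@rpredD _ P')].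
move=> a f Pf; change (ZX_scale a f \in P'); apply: rpred_sum => s _.
by apply: rpredMz; apply: actP.
Qed.

Lemma perm_act_mono (s t : 'S_n) (c : int) :
  perm_act s << c *g mono_word t >> = << c *g mono_word (t * s)%g >>.
Proof.
rewrite /perm_act malg_mapU; congr << _ *g _ >>.
rewrite /perm_word /mono_word -map_comp; apply: eq_map => i /=.
by rewrite /perm_var valK permM.
Qed.

Lemma Pn_closed : subsemimod_closed (Pn n).
Proof.
apply: subsemimod_from_act; first split.
- apply/asboolP; exists (fun=> 0).
  by rewrite big1 // => s _; rewrite monalgU0.
- move=> f g /asboolP[c ->] /asboolP[d ->]; apply/asboolP.
  exists (fun s => c s - d s); rewrite -sumrB.
  by apply: eq_bigr => s _; rewrite monalgUB.
move=> s _ /asboolP[c ->]; apply/asboolP.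
exists (fun u => c (u * s^-1)%g); rewrite raddf_sum /=.
rewrite [RHS](reindex_inj (mulIg s)) /=; apply: eq_bigr => t _.
by rewrite perm_act_mono mulgK.
Qed.
HB.instance Definition _ := GRing.isSubmodClosed.Build (ZS n) (permZX n)
  (Pn n) Pn_closed.

Lemma eval_freew (a : nat -> A) (f : ZX) (d : {fset word}) :
  (msupp f `<=` d)%fset ->
  eval_free a f = \sum_(w <- d) (\prod_(i <- w) a i) *~ f@_w.
Proof.
move=> le_d; apply/big_fset_incl => // k _ /mcoeff_outdom ->.
by rewrite mulr0z.
Qed.

Lemma eval_free_zmod (a : nat -> A) : zmod_morphism (eval_free a).
Proof.
suff evalD (f g : ZX) : eval_free a (f + g) = eval_free a f + eval_free a g.
  by move=> f g; apply/(canRL (addrK _)); rewrite -evalD subrK.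
rewrite (eval_freew a (msuppD_le f g)).
rewrite (eval_freew a (fsubsetUl (msupp f) (msupp g))).
rewrite (eval_freew a (fsubsetUr (msupp f) (msupp g))) -big_split /=.
by apply/eq_bigr => k _; rewrite mcoeffD mulrzDr.
Qed.
HB.instance Definition _ a := GRing.isZmodMorphism.Build ZX A (eval_free a)
  (eval_free_zmod a).

Lemma eval_freeU (a : nat -> A) c (w : word) :
  eval_free a << c *g w >> = (\prod_(i <- w) a i) *~ c.
Proof. by rewrite (eval_freew a msuppU_le) big_seq_fset1 mcoeffUU. Qed.

Lemma eval_free_act (a : nat -> A) (s : 'S_n) (f : ZX) :
  eval_free a (perm_act s f) = eval_free (a \o perm_var s) f.
Proof.
rewrite /perm_act /malg_map raddf_sum /=; apply: eq_bigr => w _.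
by rewrite eval_freeU /perm_word big_map.
Qed.

Lemma Id_closed : subsemimod_closed (Id A n).
Proof.
apply: subsemimod_from_act; first split.
- by apply/asboolP; split=> [|a]; [rewrite mcoeff0 | rewrite raddf0].
- move=> f g /asboolP[f0 fI] /asboolP[g0 gI]; apply/asboolP.
  split=> [|a]; first by rewrite mcoeffB f0 g0 subr0.
  by rewrite raddfB /= fI gI subr0.
move=> s f /asboolP[f0 fI]; apply/asboolP; split=> [|a].
  rewrite /perm_act /malg_map raddf_sum big1 //= => -[|i w] _.
    by rewrite f0 mcoeffU mul0rn.
  by rewrite mcoeffU.
by rewrite eval_free_act fI.
Qed.
HB.instance Definition _ := GRing.isSubmodClosed.Build (ZS n) (permZX n)
  (Id A n) Id_closed.
End PnIdSubmodules.

(* [subquot M N] is the module M / (M :&: N). *)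
Section Subquotient.
Variables (A : pzRingType) (V : lmodType A) (M N : submodClosed V).

Definition submod_type : Type := {x : V | x \in M}.
HB.instance Definition _ := SubType.copy submod_type {x : V | x \in M}.
HB.instance Definition _ := [Choice of submod_type by <:].
HB.instance Definition _ := [SubChoice_isSubLmodule of submod_type by <:].

Definition submod_meet : {pred submod_type} := fun x => val x \in N.

Lemma submod_meet_closed : subsemimod_closed submod_meet.
Proof.
split; first split.
- by rewrite unfold_in /submod_meet raddf0 rpred0.
- by move=> x y Nx Ny; rewrite unfold_in /submod_meet raddfD rpredD.
by move=> a x Nx; rewrite unfold_in /submod_meet linearZ rpredZ.
Qed.
HB.instance Definition _ := GRing.isSubmodClosed.Build A submod_type
  submod_meet submod_meet_closed.

Definition subquot : Type := Quotient.quot (submod_meet : zmodClosed submod_type).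
HB.instance Definition _ := GRing.Zmodule.on subquot.
HB.instance Definition _ := EqQuotient.copy subquot
  (Quotient.quot (submod_meet : zmodClosed submod_type)).

Definition sq_scale (a : A) (x : subquot) : subquot := \pi_subquot (a *: repr x).

Lemma sq_piD (x y : submod_type) :
  \pi_subquot (x + y) = \pi_subquot x + \pi_subquot y.
Proof. exact: (Quotient.pi_add (submod_meet : zmodClosed submod_type)). Qed.

Lemma sq_piZ a (x : submod_type) :
  \pi_subquot (a *: x) = sq_scale a (\pi_subquot x).
Proof.
apply/eqP; rewrite -(Quotient.idealrBE (submod_meet : zmodClosed submod_type)).
rewrite -scalerBr rpredZ //.
rewrite (Quotient.idealrBE (submod_meet : zmodClosed submod_type)).
by apply/eqP/esym; exact: (@reprK _ subquot).
Qed.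

Lemma sq_surj (x : subquot) : exists u, x = \pi_subquot u.
Proof. by exists (repr x); rewrite reprK. Qed.

Lemma sq_scaleA a b x : sq_scale a (sq_scale b x) = sq_scale (a * b) x.
Proof. by have [u ->] := sq_surj x; rewrite -!sq_piZ scalerA. Qed.
Lemma sq_scale1 : left_id 1 sq_scale.
Proof. by move=> x; have [u ->] := sq_surj x; rewrite -sq_piZ scale1r. Qed.
Lemma sq_scaleDr : right_distributive sq_scale +%R.
Proof.
move=> a x y; have [u ->] := sq_surj x; have [v ->] := sq_surj y.
by rewrite -sq_piD -!sq_piZ -sq_piD scalerDr.
Qed.
Lemma sq_scaleDl x : {morph sq_scale^~ x : a b / a + b}.
Proof.
move=> a b; have [u ->] := sq_surj x.
by rewrite -!sq_piZ -sq_piD scalerDl.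
Qed.
HB.instance Definition _ := GRing.Zmodule_isLmodule.Build A subquot
  sq_scaleA sq_scale1 sq_scaleDr sq_scaleDl.
End Subquotient.

Definition is_char (R : pzRingType) (l : nat) : Prop :=
  if l == 0%N then forall m : nat, (0 < m)%N -> m%:R != 0 :> R
  else l%:R = 0 :> R /\ forall m : nat, (0 < m < l)%N -> m%:R != 0 :> R.

(* The set of boxes (row, column), 0-based, of the partition la. *)
Definition diagram (la : seq nat) (b : nat * nat) : bool :=
  (b.1 < size la)%N && (b.2 < nth 0%N la b.1)%N.

(* A tableau is given by the position of each entry. *)
Record tableau (n : nat) (la : seq nat) := Tableau {
  box :> 'I_n -> nat * nat;
  box_inj : injective box;
  box_diagram : forall b, diagram la b <-> exists i, box i = b
}.

Definition hook (n k : nat) : seq nat := (n - k)%N :: nseq k 1%N.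

Section Specht.
Variables (n : nat) (la : seq nat) (T : tableau n la).

Definition row_stab : {set 'S_n} :=
  [set s : 'S_n | [forall i, (T (s i)).1 == (T i).1]].
Definition col_stab : {set 'S_n} :=
  [set s : 'S_n | [forall i, (T (s i)).2 == (T i).2]].

Definition row_sym : ZS n := [ffun s => (s \in row_stab)%:R].
Definition col_antisym : ZS n :=
  [ffun s => if s \in col_stab then (-1) ^+ odd_perm s else 0].

Definition specht : {pred (ZS n)^o} :=
  fun x => `[< exists c : ZS n, x = c * (col_antisym * row_sym) >].

Lemma specht_closed : subsemimod_closed specht.
Proof.
split; first split.
- by apply/asboolP; exists 0; rewrite mul0r.
- move=> x y /asboolP[c ->] /asboolP[d ->]; apply/asboolP.
  by exists (c + d); rewrite mulrDl.
move=> a x /asboolP[c ->]; apply/asboolP; exists (a * c).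
by rewrite -mulrA.
Qed.
HB.instance Definition _ := GRing.isSubmodClosed.Build (ZS n) (ZS n)^o
  specht specht_closed.
End Specht.

Section Multiples.
Variables (A : pzRingType) (V : lmodType A) (l : nat) (M : submodClosed V).

Definition multiples : {pred V} := fun x => `[< exists2 y, y \in M & x = y *+ l >].

Lemma multiples_closed : subsemimod_closed multiples.
Proof.
split; first split.
- by apply/asboolP; exists 0; rewrite ?rpred0 ?mul0rn.
- move=> x y /asboolP[u Mu ->] /asboolP[v Mv ->]; apply/asboolP.
  by exists (u + v); rewrite ?rpredD ?mulrnDl.
move=> a x /asboolP[u Mu ->]; apply/asboolP.
by exists (a *: u); rewrite ?rpredZ ?scalerMnr.
Qed.
HB.instance Definition _ := GRing.isSubmodClosed.Build A V
  multiples multiples_closed.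
End Multiples.

Definition specht_mod (n : nat) (la : seq nat) (T : tableau n la) (l : nat) :
    lmodType (ZS n) :=
  subquot (specht T) (multiples l (specht T)).

Definition PnId (R : comPzRingType) (n : nat) : lmodType (ZS n) :=
  subquot (Pn n) (Id (grassmann R) n).

Definition lmod_iso (A : pzRingType) (U V : lmodType A) : Prop :=
  exists phi : {linear U -> V}, bijective phi.

Lemma hook_tableau_exists (n k : nat) :
  (k < n)%N -> exists T : tableau n (hook n k), True.
Proof.
move=> lt_kn; pose m := (n - k)%N.
pose b (i : 'I_n) : nat * nat :=
  if (i < m)%N then (0%N, val i) else ((i - m).+1, 0%N).
have b_inj : injective b.
  move=> i j; rewrite /b; case: ltnP => im; case: ltnP => jm // -[] ij;
    apply: val_inj => //=.
  by rewrite -(subnK im) -(subnK jm) ij.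
suff b_diag c : diagram (hook n k) c <-> exists i, b i = c.
  by exists (Tableau b_inj b_diag).
have le_mn : (m <= n)%N by rewrite leq_subr.
have m_k : (n - m)%N = k by rewrite subKn // ltnW.
case: c => [[|r] c]; rewrite /diagram /= ?size_nseq.
  split=> [cm | [i]].
    by exists (Ordinal (leq_trans cm le_mn)); rewrite /b /= cm.
  by rewrite /b; case: ltnP => // im [<-].
rewrite ltnS nth_nseq; split=> [/andP[rk] | [i]].
  rewrite rk ltnS leqn0 => /eqP ->.
  have lt_in : (r + m < n)%N by rewrite addnC -ltn_subRL m_k.
  exists (Ordinal lt_in); rewrite /b /=.
  by rewrite ltnNge leq_addl /= addnK.
rewrite /b; case: ltnP => // im [<- <-].
have ikl : (i - m < k)%N by rewrite -m_k ltn_sub2r //; apply: leq_ltn_trans (ltn_ord i).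
by rewrite !ikl.
Qed.

(* Main.v *)
Require Import Defs.
From HB Require Import structures.
From mathcomp Require Import all_boot all_fingroup all_algebra.
From mathcomp Require Import generic_quotient ring_quotient finmap boolp.
From mathcomp Require Import ring zify.
From mathcomp.multinomials Require Import monalg.

Set Implicit Arguments.
Unset Strict Implicit.
Unset Printing Implicit Defensive.

Import GRing.Theory.
Local Open Scope ring_scope.
Local Open Scope quotient_scope.

(** The multilinear identities of the Grassmann algebra are read off in an exterior
    algebra. Write an element of the Grassmann algebra as the sum of its even part,
    which is central, and its odd part; odd parts anticommute. Evaluating the
    monomial [x_s(1) ... x_s(n)] then amounts to expanding the ordered product of
    the [1 + v_s(i)] in the exterior algebra on [v_1, ..., v_n] over the integers.
    The resulting map from P_n, called [symbol], is equivariant, and a multilinear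
    polynomial is an identity exactly when all coefficients of its symbol are
    divisible by [l] ([Id_grassmannP]). So the module to be filtered is the image
    of [symbol] modulo [l].

    That image is explicit. The commutator of [1 + v_x] and [1 + v_y] is
    [2 v_x v_y], which is central; sorting the factors therefore shows that every
    symbol is one fixed ordered product of the [1 + v_i] times an element of the
    ring generated by the [2 v_x v_y] ([symbol_decomposition]). As [1 + v_i] is
    unipotent for the degree, the filtration by degree has layers
    [2 ^ (m / 2)] times the [m]-th exterior power, for [m] even; the odd degrees
    bring nothing new. The layers are attained by iterated commutators
    ([symbol_realizes]), and the powers of 2 are harmless because [l] is odd or 0.

    Each layer splits in two. Contraction with the functional that is 1 on every
    [v_j] makes the exterior algebra an exact Koszul complex, with exterior
    multiplication by one [v_x] as contracting homotopy ([boundary_wedge]). Hence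
    the [m]-th exterior power is an extension of the boundaries of degree [m - 1] by
    those of degree [m]. Finally, the boundaries of degree [k] are the Specht module
    of the hook [(n - k, 1^k)] ([spechtP]): the column antisymmetrizer produces the
    exterior product of the letters of the first column, and the row symmetrizer
    forgets the image of the corner, which is contraction. So every [k < n] occurs
    once, from the layer [m = k] if [k] is even and [m = k + 1] if [k] is odd.
    Everything is done over the integers with pure sublattices, so reduction
    modulo [l] preserves the factors ([filtration_factor]).

    Elements of the exterior algebra are represented by their coefficient functions
    on words, which makes the symmetric group act by renaming letters and embeds
    forms of degree [k] in the group ring, where the Specht module lives. *)

Lemma dvdzD (d a b : int) : (d %| a)%Z -> (d %| b)%Z -> (d %| a + b)%Z.
Proof. exact: rpredD. Qed.

Lemma dvdzB (d a b : int) : (d %| a)%Z -> (d %| b)%Z -> (d %| a - b)%Z.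
Proof. exact: rpredB. Qed.

(** * Signed shuffles and alternating functions on words *)

Section Forms.
Variable T : eqType.
Implicit Types (f g : seq T -> int) (x y i j : T) (t u v w : seq T).

(** Exterior multiplication by [v_x] on coefficient functions: at a word [t] of
    distinct letters, [g t] stands for the coefficient of the product of the [v_i]
    along [t]. It is encoded as the signed shuffle of [x] into words, so that the
    sign rules hold for all functions on words and not only for alternating ones. *)
Fixpoint wedge x g t : int :=
  if t is i :: t' then (if i == x then g t' else 0) - wedge x (fun u => g (i :: u)) t'
  else 0.

(** The integers have no 2-torsion, so such a function vanishes on words with a
    repeated letter, as the coefficients of an element of an exterior algebra do. *)
Definition alternating g :=
  forall u i j v, g (u ++ i :: j :: v) = - g (u ++ j :: i :: v).

Definition unit_form t : int := (t == [::])%:R.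

(** Multiplication by the ordered product of the [1 + v_x], [x] in [w]. *)
Definition grow w g := foldr (fun x g t => g t + wedge x g t) g w.

(** Multiplication by the ordered product of the [v_x], [x] in [w]; the basis
    element [v_w] of the exterior algebra is [blade w unit_form]. *)
Definition blade w g := foldr wedge g w.

Lemma wedgeD x g1 g2 t :
  wedge x (fun u => g1 u + g2 u) t = wedge x g1 t + wedge x g2 t.
Proof.
elim: t g1 g2 => [|i t IH] g1 g2 /=; first by rewrite addr0.
by rewrite IH; case: eqP => _; ring.
Qed.

Lemma wedgeZ x (a : int) g t : wedge x (fun u => a * g u) t = a * wedge x g t.
Proof.
elim: t g => [|i t IH] g /=; first by rewrite mulr0.
by rewrite IH; case: eqP => _; ring.
Qed.

Lemma wedge_sum (J : finType) x (g : J -> seq T -> int) t :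
  wedge x (fun u => \sum_j g j u) t = \sum_j wedge x (g j) t.
Proof.
elim: t g => [|i t IH] g /=; first by rewrite big1.
by rewrite IH sumrB; case: eqP => _; rewrite ?big1_eq.
Qed.

Lemma wedge_wedge x y g i t : wedge x (wedge y g) (i :: t) =
  (if i == x then wedge y g t else 0) - (if i == y then wedge x g t else 0)
  + wedge x (wedge y (fun u => g (i :: u))) t.
Proof.
rewrite [LHS]/=; set F := (X in wedge x X t).
have -> : F = fun u => (if i == y then g u else 0)
  + -1 * wedge y (fun v => g (i :: v)) u.
  by apply: funext => u; rewrite mulN1r.
rewrite wedgeD wedgeZ.
have -> : wedge x (fun u => if i == y then g u else 0) t
    = if i == y then wedge x g t else 0.
  case: eqP => // _; rewrite (_ : (fun _ => _) = fun u => 0 * g u).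
    by rewrite wedgeZ mul0r.
  by apply: funext => u; rewrite mul0r.
by ring.
Qed.

Lemma wedgeC x y g t : wedge x (wedge y g) t = - wedge y (wedge x g) t.
Proof.
elim: t g => [|i t IH] g; first by rewrite /= oppr0.
by rewrite !wedge_wedge IH; ring.
Qed.

Lemma wedgeCf x y g : wedge x (wedge y g) = fun t => - wedge y (wedge x g) t.
Proof. by apply: funext => t; rewrite wedgeC. Qed.

Lemma wedgexx x g t : wedge x (wedge x g) t = 0.
Proof. by have := wedgeC x x g t; lia. Qed.

Lemma alternating_cons g i : alternating g -> alternating (fun u => g (i :: u)).
Proof. by move=> Ag u j k v; apply: (Ag (i :: u)). Qed.

Lemma wedge_alternating x g : alternating g -> alternating (wedge x g).
Proof.
move=> Ag u i j v; elim: u g Ag => [|k u IH] g Ag.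
  rewrite /=; have -> : (fun u => g (i :: j :: u)) = fun u => -1 * g (j :: i :: u).
    by apply: funext => u; rewrite (Ag [::]) mulN1r.
  by rewrite wedgeZ; ring.
rewrite /= IH; last exact: alternating_cons.
by rewrite Ag; case: eqP => _; ring.
Qed.

(** The value at a word is a signed sum of values at words one letter shorter.
    For [d = 0] the same statement transports vanishing. *)
Lemma wedge_dvd x g m (d : int) :
    (forall t, size t = m -> (d %| g t)%Z) ->
  forall t, size t = m.+1 -> (d %| wedge x g t)%Z.
Proof.
elim: m g => [|m IH] g dg [//|i t] /= [st].
  by case: t st => // _; rewrite /= subr0; case: eqP => // _; apply: dg.
apply: dvdzB; first by case: eqP => // _; apply: dg.
by apply: IH => // u su; apply: dg; rewrite /= su.
Qed.

Lemma wedge_dvd_lt x g m (d : int) :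
    (forall t, size t < m -> (d %| g t)%Z)%N ->
  forall t, (size t <= m)%N -> (d %| wedge x g t)%Z.
Proof.
move=> dg [|i t] st; first by rewrite dvdz0.
by apply: (@wedge_dvd x g (size t)) => // u su; apply: dg; rewrite su.
Qed.

(** A product of factors [1 + v_x] is the identity plus operators that raise the
    degree, so it does not affect the lowest degree of [g], even modulo [d]. *)
Lemma grow_dvd w g m (d : int) :
    (forall t, size t < m -> (d %| g t)%Z)%N ->
  forall t, (size t <= m)%N -> (d %| grow w g t - g t)%Z.
Proof.
move=> dg; elim: w => [|x w IH] t st /=; first by rewrite subrr dvdz0.
rewrite addrAC; apply: dvdzD; first exact: IH.
apply: (@wedge_dvd_lt _ _ m) => // u su.
rewrite -[grow w g u](subrK (g u)); apply: dvdzD; last exact: dg.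
by apply: IH; apply: ltnW.
Qed.

Lemma grow_alternating w g : alternating g -> alternating (grow w g).
Proof.
move=> Ag; elim: w => //= x w IH u i j v.
by rewrite IH (wedge_alternating _ IH) opprD.
Qed.

Lemma blade_alternating w g : alternating g -> alternating (blade w g).
Proof. by move=> Ag; elim: w => //= x w; apply: wedge_alternating. Qed.

Lemma unit_form_alternating : alternating unit_form.
Proof. by move=> [|k u] i j v; rewrite /unit_form /= oppr0. Qed.

Lemma growD w g1 g2 t :
  grow w (fun u => g1 u + g2 u) t = grow w g1 t + grow w g2 t.
Proof.
elim: w t => //= x w IH t; rewrite IH (funext IH) wedgeD; ring.
Qed.

Lemma growZ w (a : int) g t : grow w (fun u => a * g u) t = a * grow w g t.
Proof. by elim: w t => //= x w IH t; rewrite IH (funext IH) wedgeZ; ring. Qed.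

Lemma grow_sum (J : finType) w (g : J -> seq T -> int) t :
  grow w (fun u => \sum_j g j u) t = \sum_j grow w (g j) t.
Proof.
by elim: w t => //= x w IH t; rewrite IH (funext IH) wedge_sum -big_split.
Qed.

Lemma wedgeN x g t : wedge x (fun u => - g u) t = - wedge x g t.
Proof.
rewrite -mulN1r -wedgeZ; congr wedge; apply: funext => u.
by rewrite mulN1r.
Qed.

Lemma wedge0 x t : wedge x (fun=> 0) t = 0.
Proof. by rewrite (wedgeZ x 0 (fun=> 0)) mul0r. Qed.

(** Products of two odd elements are central. *)
Lemma wedge2C x y z g :
  wedge z (wedge x (wedge y g)) = wedge x (wedge y (wedge z g)).
Proof.
apply: funext => t; rewrite wedgeC (wedgeCf z y) wedgeN opprK //.
Qed.

Lemma grow_wedge2 w x y g :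
  grow w (wedge x (wedge y g)) = wedge x (wedge y (grow w g)).
Proof.
elim: w => //= z w ->; apply: funext => t.
rewrite wedge2C -wedgeD; congr wedge; apply: funext => u.
by rewrite -wedgeD.
Qed.

Lemma grow_cat u w g : grow (u ++ w) g = grow u (grow w g).
Proof. exact: foldr_cat. Qed.

(** The commutator of [1 + v_x] and [1 + v_y] is [2 v_x v_y]. *)
Lemma grow_pair x y g :
  grow [:: x; y] g = fun t => grow [:: y; x] g t + 2 * wedge x (wedge y g) t.
Proof. by apply: funext => t; rewrite /= !wedgeD (wedgeC y x); ring. Qed.

Lemma wedge2_grow x y g t :
  wedge x (wedge y (grow [:: y; x] g)) t = wedge x (wedge y g) t.
Proof.
have sq0 z f : wedge z (wedge z f) = fun=> 0 by apply: funext => u; rewrite wedgexx.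
by rewrite -grow_wedge2 /= wedgeD !sq0 (wedgeC y x) sq0 !wedge0; ring.
Qed.

(** Exchanging two adjacent factors costs [1 + 2 v_x v_y]: this factor absorbs the
    commutator because [v_x v_y] is killed by [v_x] and by [v_y], and it can be
    moved to the far right because it is central. *)
Lemma grow_swap u x y v g : grow (u ++ x :: y :: v) g =
  grow (u ++ y :: x :: v) (fun t => g t + 2 * wedge x (wedge y g) t).
Proof.
rewrite -(cat1s x) -(cat1s y v) -(cat1s y (x :: v)) -(cat1s x v) !grow_cat.
congr grow; apply: funext => t.
have -> : grow v (fun t => g t + 2 * wedge x (wedge y g) t) =
   fun t => grow v g t + 2 * wedge x (wedge y (grow v g)) t.
  by apply: funext => s; rewrite growD growZ grow_wedge2.
by rewrite -!(grow_cat [:: _] [:: _]) !cat1s growD growZ grow_pair grow_wedge2 wedge2_grow.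
Qed.

(** Bubble sort. The prefix [p] in the proof lets the induction pass under the
    first letter, because the relation is not assumed to be stable under [cons]. *)
Lemma perm_adjacent_ind (Rel : seq T -> seq T -> Prop) :
    (forall u, Rel u u) -> (forall u v w, Rel u v -> Rel v w -> Rel u w) ->
    (forall u x y v, Rel (u ++ x :: y :: v) (u ++ y :: x :: v)) ->
  forall u w, perm_eq u w -> Rel u w.
Proof.
move=> refl trans adj u w uw; rewrite -[u]cat0s -[w]cat0s.
have move_to p x v1 v2 : Rel (p ++ x :: v1 ++ v2) (p ++ v1 ++ x :: v2).
  elim: v1 p => [|y v1 IH] p //=.
  by apply: trans (adj _ _ _ _) _; have := IH (rcons p y); rewrite !cat_rcons.
elim: u w [::] uw => [|x u IH] w p.
  by rewrite perm_sym => /perm_nilP ->.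
move=> uw; have xw : x \in w by rewrite -(perm_mem uw) mem_head.
case/splitPr: xw uw => w1 w2 uw.
apply: trans (move_to _ _ _ _).
have := IH (w1 ++ w2) (rcons p x); rewrite !cat_rcons; apply.
by move: uw; rewrite perm_sym -cat1s perm_catCA perm_cons perm_sym.
Qed.

Lemma alternating_perm_eq f g u w : alternating f -> alternating g ->
  perm_eq u w -> f w = g w -> f u = g u.
Proof.
move=> Af Ag uw; elim/perm_adjacent_ind: uw => // [u' v w' h1 h2 /h2/h1 //|].
by move=> u' x y v; rewrite Af (Ag u' y) => /oppr_inj.
Qed.

Lemma alternating_not_uniq g t : alternating g -> ~~ uniq t -> g t = 0.
Proof.
elim: t g => // x t IH g Ag; rewrite /= negb_and negbK => /orP[xt|]; last first.
  exact: (IH (fun u => g (x :: u)) (alternating_cons x Ag)).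
have Az : alternating (fun=> 0) by move=> *; rewrite oppr0.
apply: (@alternating_perm_eq g (fun=> 0) _ (x :: x :: rem x t)) => //.
  by rewrite perm_cons perm_to_rem.
by have := Ag [::] x x (rem x t); rewrite /=; lia.
Qed.

Lemma wedge_notin x z g : (forall u, z \in u -> g u = 0) -> z != x ->
  forall t, z \in t -> wedge x g t = 0.
Proof.
move=> g0 zx t; elim: t g g0 => //= i t IH g g0.
rewrite inE; have [<- _|zi /= zt] := eqVneq z i.
  rewrite (negPf zx) (_ : (fun u => _) = fun=> 0) ?wedge0 ?subr0 //.
  by apply: funext => u; rewrite g0 ?mem_head.
rewrite IH ?subr0 //; first by case: eqP => // _; apply: g0.
by move=> u zu; apply: g0; rewrite inE zu orbT.
Qed.

Lemma wedge_out x g t : x \notin t -> wedge x g t = 0.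
Proof.
elim: t g => //= i t IH g; rewrite inE negb_or eq_sym => /andP[/negPf -> xt].
by rewrite IH // subr0.
Qed.

Lemma wedge_homogeneous x g m : (forall t, size t != m -> g t = 0) ->
  forall t, size t != m.+1 -> wedge x g t = 0.
Proof.
move=> g0 [//|i t] tm; apply/eqP; rewrite -dvd0z.
by apply: (@wedge_dvd x g (size t) 0) => // u su; rewrite dvd0z g0 // su.
Qed.

Lemma grow_notin w z t : z \notin w -> z \in t -> grow w unit_form t = 0.
Proof.
elim: w t => [|x w IH] t /=; first by case: t.
rewrite inE negb_or => /andP[zx zw] zt; rewrite IH // add0r.
by apply: (wedge_notin (z := z)) => // u; apply: IH.
Qed.

Lemma blade_notin w z t : z \notin w -> z \in t -> blade w unit_form t = 0.
Proof.
elim: w t => [|x w IH] t /=; first by case: t.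
rewrite inE negb_or => /andP[zx zw] zt.
by apply: (wedge_notin (z := z)) => // u; apply: IH.
Qed.

Lemma blade_size w t : size t != size w -> blade w unit_form t = 0.
Proof.
elim: w t => [|x w IH] t /=; first by case: t.
exact: wedge_homogeneous.
Qed.

Lemma blade_self w : uniq w -> blade w unit_form w = 1.
Proof.
elim: w => //= x w IH /andP[xw /IH ->]; rewrite eqxx.
rewrite (_ : (fun u => _) = fun=> 0) ?wedge0 ?subr0 //.
by apply: funext => u; rewrite (blade_notin xw) ?mem_head.
Qed.

Lemma blade_dvd w g m (d : int) :
    (forall t, size t < m -> (d %| g t)%Z)%N ->
  forall t, (size t < size w + m)%N -> (d %| blade w g t)%Z.
Proof.
move=> dg; elim: w => //= x w IH t st.
by apply: wedge_dvd_lt st.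
Qed.

Lemma bladeD w g1 g2 t :
  blade w (fun u => g1 u + g2 u) t = blade w g1 t + blade w g2 t.
Proof. by elim: w t => //= x w IH t; rewrite (funext IH) wedgeD. Qed.

Lemma bladeZ w (a : int) g t : blade w (fun u => a * g u) t = a * blade w g t.
Proof. by elim: w t => //= x w IH t; rewrite (funext IH) wedgeZ. Qed.

Lemma blade_wedge2 w x y g :
  blade w (wedge x (wedge y g)) = wedge x (wedge y (blade w g)).
Proof. by elim: w => //= z w ->; rewrite wedge2C. Qed.

(** The next two facts say that [v_w] is the component of lowest degree of the
    product of [v_w] with factors [1 + v_i]. *)
Lemma blade_grow_low w u t : (size t < size w)%N ->
  blade w (grow u unit_form) t = 0.
Proof.
move=> st; apply/eqP; rewrite -dvd0z.
by apply: (@blade_dvd w _ 0) => //; rewrite addn0.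
Qed.

Lemma blade_grow_top w u t : size t = size w ->
  blade w (grow u unit_form) t = blade w unit_form t.
Proof.
move=> st; apply/eqP; rewrite -subr_eq0 -dvd0z -mulN1r -bladeZ -bladeD.
apply: (@blade_dvd w _ 1 0); last by rewrite st addn1.
move=> s; rewrite ltnS => s0; rewrite mulN1r.
by apply: (@grow_dvd u unit_form 0).
Qed.

(** Iterated commutators: since [2 v_x v_y] is the commutator of [1 + v_x] and
    [1 + v_y] and is central, [2 ^ p] times [v_w] times the product over [u] is a
    signed sum of ordered products over rearrangements of [w ++ u]. *)
Lemma blade_commutator (K : (seq T -> int) -> Prop) r :
    (forall f g, K f -> K g -> K (fun t => f t - g t)) ->
    (forall w, perm_eq w r -> K (grow w unit_form)) ->
  forall p w u, size w = p.*2 -> perm_eq (w ++ u) r ->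
    K (fun t => 2 ^+ p * blade w (grow u unit_form) t).
Proof.
move=> KB Kr; elim=> [|p IH] w u.
  case: w => // _ /Kr; congr K; apply: funext => t; by rewrite mul1r.
case: w => [|x [|y w]] //= [sw] wur.
rewrite (_ : (fun t => _) = fun t =>
    2 ^+ p * blade w (grow (x :: y :: u) unit_form) t
  - 2 ^+ p * blade w (grow (y :: x :: u) unit_form) t).
  have perm_r a b : perm_eq (w ++ a :: b :: u) (a :: b :: w ++ u).
    exact/permPl/(perm_catCA w [:: a; b] u).
  apply: KB; apply: IH => //.
    exact: perm_trans (perm_r _ _) wur.
  apply: perm_trans (perm_r _ _) _; apply: perm_trans wur.
  exact/permPl/(perm_catCA [:: y] [:: x] (w ++ u)).
apply: funext => t.
rewrite (grow_pair x y (grow u unit_form) : grow (x :: y :: u) _ = _).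
by rewrite bladeD bladeZ blade_wedge2 exprS /=; ring.
Qed.

(** For finite [T], the subring generated by the [2 v_x v_y], that is the integral
    span of the elements [2 ^ (m / 2) v_J] with [J] of even size [m], in terms of
    coefficients; divisibility by 0 makes the odd degrees vanish. *)
Definition pair_lattice g := alternating g /\
  forall t, ((if odd (size t) then 0 else 2 ^+ (size t)./2) %| g t)%Z.

Lemma pair_lattice_unit : pair_lattice unit_form.
Proof.
split=> [|[|i t]]; first exact: unit_form_alternating.
  by rewrite dvd1z.
by rewrite dvdz0.
Qed.

Lemma pair_lattice_wedge2 x y g :
  pair_lattice g -> pair_lattice (fun t => g t + 2 * wedge x (wedge y g) t).
Proof.
move=> [Ag dg]; split=> [u i j v|].
  by rewrite Ag (wedge_alternating x (wedge_alternating y Ag)); ring.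
move=> t; apply: dvdzD => //.
case: t => [|i [|j t]]; first by rewrite dvd1z.
  by rewrite /= !if_same !subr0 mulr0 dvdz0.
set d : int := if odd (size t) then 0 else 2 ^+ (size t)./2.
have dw : (d %| wedge x (wedge y g) (i :: j :: t))%Z.
  apply: (@wedge_dvd x (wedge y g) (size t).+1) => // s ss.
  by apply: (@wedge_dvd y g (size t)) ss => u su; have := dg u; rewrite su.
rewrite /= negbK; move: dw; rewrite /d; case: (odd _) => dw.
  exact: dvdz_mull.
by rewrite exprS dvdz_mul.
Qed.

(** Sorting [w] into [r] leaves one factor [1 + 2 v_x v_y] for each exchange. *)
Lemma grow_perm w r f : perm_eq w r -> pair_lattice f ->
  exists2 f', pair_lattice f' & grow w f = grow r f'.
Proof.
move=> wr; elim/perm_adjacent_ind: wr f => [u f Ef|u v z IH1 IH2 f Ef|u a b v f Ef].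
- by exists f.
- have [f1 Ef1 ->] := IH1 f Ef; exact: IH2.
rewrite grow_swap; exists (fun t => f t + 2 * wedge a (wedge b f) t) => //.
exact: pair_lattice_wedge2.
Qed.

Lemma pair_lattice_sum (J : finType) (c : J -> int) (f : J -> seq T -> int) :
  (forall k, pair_lattice (f k)) -> pair_lattice (fun t => \sum_k c k * f k t).
Proof.
move=> Ef; split=> [u i j v|t].
  by rewrite -sumrN; apply: eq_bigr => k _; rewrite (proj1 (Ef k)) mulrN.
by apply: rpred_sum => k _; apply: dvdz_mull; apply: (proj2 (Ef k)).
Qed.

(** Factoring out the product over one reference word turns a combination of
    products in many different orders into an element of a lattice whose homogeneous
    components are explicit. *)
Lemma grow_combination (J : finType) (c : J -> int) (w : J -> seq T) r :
    (forall k, perm_eq (w k) r) ->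
  exists2 f, pair_lattice f &
    forall t, \sum_k c k * grow (w k) unit_form t = grow r f t.
Proof.
move=> wr; have /choice[f Ef] : forall k, exists f',
    pair_lattice f' /\ grow (w k) unit_form = grow r f'.
  by move=> k; have [f' ? ?] := grow_perm (wr k) pair_lattice_unit; exists f'.
exists (fun t => \sum_k c k * f k t).
  by apply: pair_lattice_sum => k; case: (Ef k).
move=> t; rewrite grow_sum; apply: eq_bigr => k _.
by rewrite growZ; case: (Ef k) => _ ->.
Qed.

(** Multiplication by the factors [1 + v_x] is unitriangular for the degree, and
    [f] has no odd part; so the even degrees of the product determine [f] modulo [l]
    from the bottom up. *)
Lemma pair_lattice_low r f m (l : int) : pair_lattice f ->
    (forall t, (size t < m)%N -> ~~ odd (size t) -> (l %| grow r f t)%Z) ->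
  forall t, (size t < m)%N -> (l %| f t)%Z.
Proof.
move=> [_ df] dr; suff IH k : (k <= m)%N ->
    forall t, (size t < k)%N -> (l %| f t)%Z by apply: IH.
elim: k => // k IH km t; rewrite ltnS => tk.
case: (boolP (odd (size t))) => ot.
  by have := df t; rewrite ot dvd0z => /eqP ->; rewrite dvdz0.
rewrite -[f t](subKr (grow r f t)); apply: dvdzB.
  by apply: dr => //; apply: leq_ltn_trans tk km.
by apply: (@grow_dvd r f k) => // u uk; apply: IH => //; apply: ltnW.
Qed.

Lemma alternating_cut g m : alternating g ->
  alternating (fun t => if size t == m then g t else 0).
Proof.
move=> Ag u i j v; rewrite !size_cat /= Ag.
by case: eqP => _; rewrite ?oppr0.
Qed.

Lemma alternating_divides g m (d : int) : alternating g ->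
    (forall t, size t = m -> (d %| g t)%Z) ->
  exists2 f, alternating f & forall t, size t = m -> g t = d * f t.
Proof.
move=> Ag dg; have [dz|d0] := eqVneq d 0; last first.
  (* The function is cut to degree m, as nothing is known in other degrees. *)
  exists (fun t => (if size t == m then g t else 0) %/ d)%Z.
    move=> u i j v; rewrite (alternating_cut m Ag).
    have dd : (d %| (if size (u ++ j :: i :: v) == m then g (u ++ j :: i :: v) else 0))%Z.
      by case: eqP => [/dg//|_]; rewrite dvdz0.
    by case/dvdzP: dd => q ->; rewrite -mulNr !mulzK.
  by move=> t st; rewrite st eqxx mulrC divzK // dg.
exists (fun=> 0); first by move=> *; rewrite oppr0.
by move=> t st; rewrite mulr0; apply/eqP; rewrite -dvd0z -dz dg.
Qed.

(** The [v_t] span the alternating functions of degree [m] over the integers. To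
    avoid dividing by factorials, the letters are split off one at a time:
    [f = v_x f_x + f'], where neither [f_x], the contraction of [f] by [x], nor [f']
    involves [x]. The span is replaced by an arbitrary additive property [K], because
    the induction applies the statement to [K] composed with [wedge x]. *)
Lemma alternating_span (K : (seq T -> int) -> Prop) X m f :
    (forall g g', K g -> (forall t, size t = m -> g t = g' t) -> K g') ->
    (forall (a : int) g g', K g -> K g' -> K (fun t => a * g t + g' t)) ->
    K (fun=> 0) ->
    (forall t, uniq t -> {subset t <= X} -> size t = m -> K (blade t unit_form)) ->
  uniq X -> (forall i t, i \notin X -> f (i :: t) = 0) ->
  alternating f -> K f.
Proof.
elim: X K m f => [|x X IH] K m f Keq KD K0 Kb.
  move=> _ f0 Af; case: m Keq Kb => [|m] Keq Kb; last first.
    by apply: Keq K0 _ => -[|i t] // _; rewrite f0.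
  apply: Keq (KD (f [::]) _ _ (Kb [::] _ _ _) K0) _ => // -[|//] _.
  by rewrite addr0 /unit_form mulr1.
rewrite cons_uniq => /andP[xX uX] f0 Af; pose fx u := f (x :: u).
have Afx : alternating fx by apply: alternating_cons.
have fxx u : fx (x :: u) = 0 by have := Af [::] x x u; rewrite /fx /=; lia.
have Kfx : K (wedge x fx).
  case: m Keq Kb => [|m] Keq Kb.
    by apply: Keq K0 _ => -[|//] _.
  apply: (IH (fun g => K (wedge x g)) m) => //.
  - move=> g g' Kg gg'; apply: Keq Kg _ => t st; apply/eqP; rewrite -subr_eq0.
    rewrite -mulN1r -wedgeZ -wedgeD -dvd0z; apply: (@wedge_dvd _ _ m) => // u su.
    by rewrite gg' // mulN1r subrr.
  - move=> a g g' Kg Kg'.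
    rewrite (_ : wedge x _ = fun t => a * wedge x g t + wedge x g' t).
      exact: KD.
    by apply: funext => t; rewrite wedgeD wedgeZ.
  - by rewrite (_ : wedge x _ = fun=> 0) //; apply: funext => t; rewrite wedge0.
  - move=> t ut tX st; apply: (Kb (x :: t)) => //=; last by rewrite st.
      by rewrite ut andbT; apply: contra xX => /tX.
    by move=> z; rewrite !inE => /orP[->//|/tX ->]; rewrite orbT.
  move=> i t iX; rewrite /fx; have [->|ix] := eqVneq i x; first exact: fxx.
  by rewrite (Af [::]) /= f0 ?oppr0 // inE negb_or ix.
pose f' t := -1 * wedge x fx t + f t.
rewrite (_ : f = fun t => 1 * wedge x fx t + f' t); last first.
  by apply: funext => t; rewrite /f'; ring.
apply: (KD 1 (wedge x fx) f' Kfx); apply: (IH K m f' Keq KD K0) => //.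
- move=> t ut tX st; apply: Kb => // z /tX zX.
  by rewrite inE zX orbT.
- move=> i t iX; rewrite /f' /=; have [->|ix] := eqVneq i x.
    rewrite (_ : (fun u => fx _) = fun=> 0) ?wedge0; last exact: funext.
    by rewrite /fx; ring.
  have iX' : i \notin x :: X by rewrite inE negb_or ix.
  have -> : (fun u => fx (i :: u)) = fun=> 0.
    by apply: funext => u; rewrite /fx (Af [::]) /= f0 ?oppr0.
  by rewrite wedge0 f0 // if_same; ring.
move=> u i j v; rewrite /f' (wedge_alternating _ Afx) Af; ring.
Qed.

End Forms.

(** * The Koszul complex *)

Section Boundary.
Variable T : finType.
Implicit Types (f g h : seq T -> int) (t u : seq T).

(** Contraction with the functional that takes the value 1 on each [v_j]. *)
Definition boundary g t : int := \sum_(j : T) g (j :: t).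

Lemma boundaryD g1 g2 t :
  boundary (fun u => g1 u + g2 u) t = boundary g1 t + boundary g2 t.
Proof. exact: big_split. Qed.

Lemma boundaryZ (a : int) g t : boundary (fun u => a * g u) t = a * boundary g t.
Proof. by rewrite /boundary mulr_sumr. Qed.

Lemma eq_boundary m f g : (forall t, size t = m.+1 -> f t = g t) ->
  forall t, size t = m -> boundary f t = boundary g t.
Proof. by move=> fg t st; apply: eq_bigr => j _; apply: fg; rewrite /= st. Qed.

Lemma boundary_alternating g : alternating g -> alternating (boundary g).
Proof.
move=> Ag u i j v; rewrite /boundary -sumrN; apply: eq_bigr => k _.
exact: (Ag (k :: u)).
Qed.

Lemma boundary_boundary g t : alternating g -> boundary (boundary g) t = 0.
Proof.
move=> Ag; suff : boundary (boundary g) t = - boundary (boundary g) t by lia.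
rewrite /boundary [LHS]exchange_big /= -sumrN; apply: eq_bigr => i _.
rewrite -sumrN; apply: eq_bigr => j _; exact: (Ag [::]).
Qed.

(** Multiplication by any [v_x] is a contracting homotopy of the Koszul complex. *)
Lemma boundary_wedge (x : T) g t :
  boundary (wedge x g) t = g t - wedge x (boundary g) t.
Proof.
rewrite /boundary wedge_sum sumrB (bigD1 x) //= eqxx big1 ?addr0 //.
by move=> i /negPf ->.
Qed.

(** Applied to the homotopy formula, divisibility of [boundary g] makes its error
    term [wedge x (boundary g)] divisible. For [l = 0] this is exactness. *)
Lemma boundary_exact_mod (x : T) (l : int) m g : alternating g ->
    (forall t, (size t).+1 = m -> (l %| boundary g t)%Z) ->
  exists h h', [/\ alternating h, alternating h' &
    forall t, size t = m -> g t = boundary h t + l * h' t].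
Proof.
move=> Ag dg.
have [t st|h' Ah' h'E] := @alternating_divides _ (wedge x (boundary g)) m l
  (wedge_alternating x (boundary_alternating Ag)).
  case: t st => [|i t] st; first by rewrite dvdz0.
  by apply: (@wedge_dvd _ x _ (size t)) => // u su; apply: dg; rewrite su.
exists (wedge x g), h'; split=> // [|t st]; first exact: wedge_alternating.
by rewrite boundary_wedge -h'E // subrK.
Qed.
End Boundary.

(** * Renaming letters *)

Lemma wedge_map (T1 T2 : eqType) (s : T1 -> T2) x g t : injective s ->
  wedge (s x) g (map s t) = wedge x (fun u => g (map s u)) t.
Proof.
move=> s_inj; elim: t g => //= i t IH g.
by rewrite (inj_eq s_inj) IH.
Qed.

Lemma grow_map (T1 T2 : eqType) (s : T1 -> T2) w t : injective s ->
  grow (map s w) (@unit_form T2) (map s t) = grow w (@unit_form T1) t.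
Proof.
move=> s_inj; elim: w t => [|x w IH] t /=; first by case: t.
by rewrite wedge_map // IH (funext IH).
Qed.

Lemma blade_map (T1 T2 : eqType) (s : T1 -> T2) w t : injective s ->
  blade (map s w) (@unit_form T2) (map s t) = blade w (@unit_form T1) t.
Proof.
move=> s_inj; elim: w t => [|x w IH] t /=; first by case: t.
by rewrite wedge_map // (funext IH).
Qed.

Lemma perm_eq_enum n (w : seq 'I_n) : perm_eq w (enum 'I_n) ->
  exists s : 'S_n, w = map s (enum 'I_n).
Proof.
move=> wE; have sw : size w == n by rewrite (perm_size wE) size_enum_ord.
have /tuple_permP[s ws] : perm_eq (Tuple sw) (ord_tuple n).
  by rewrite val_ord_tuple.
exists s; move: ws => /= ->.
by apply: eq_map => i /=; rewrite tnth_ord_tuple.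
Qed.

Lemma perm_map_enum n (s : 'S_n) : perm_eq (map s (enum 'I_n)) (enum 'I_n).
Proof.
apply: uniq_perm; rewrite ?enum_uniq ?(map_inj_uniq (@perm_inj _ s)) ?enum_uniq //.
by move=> i; rewrite mem_enum -[i](permKV s) map_f ?mem_enum.
Qed.

Lemma perm_eq_complete n (t : seq 'I_n) : uniq t ->
  exists u, perm_eq (t ++ u) (enum 'I_n).
Proof.
move=> ut; exists (filter (fun i => i \notin t) (enum 'I_n)).
apply: uniq_perm; rewrite ?enum_uniq //.
  rewrite cat_uniq ut filter_uniq ?enum_uniq // andbT /=.
  by apply/hasPn => i; rewrite mem_filter => /andP[].
by move=> i; rewrite mem_cat mem_filter mem_enum andbT orbN.
Qed.

Lemma perm_extension n (t u : seq 'I_n) : uniq t -> uniq u -> size t = size u ->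
  exists s : 'S_n, map s t = u.
Proof.
move=> ut uu stu; have [t' /perm_eq_enum[p tp]] := perm_eq_complete ut.
have [u' /perm_eq_enum[q uq]] := perm_eq_complete uu.
exists (p^-1 * q)%g; have : map (p^-1 * q)%g (t ++ t') = u ++ u'.
  rewrite tp uq -map_comp; apply: eq_map => i /=.
  by rewrite permM permK.
rewrite map_cat => /(congr1 (take (size u))).
by rewrite !take_size_cat // size_map.
Qed.

(** * Symbols of multilinear polynomials *)

Section Words.
Variable n : nat.
Implicit Types (a c : ZS n) (s : 'S_n) (t : seq 'I_n) (l : int).

(** The image in the exterior algebra of the multilinear polynomial with
    coefficients [c], each variable [x_i] being replaced by [1 + v_i]. *)
Definition symbol c t : int :=
  \sum_(s : 'S_n) c s * grow (map s (enum 'I_n)) (@unit_form _) t.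

(** An even degree [m] carries up to two hooks: one is seen by the boundary of the
    component of degree [m] and has level [m - 1], if [0 < m], the other is seen by
    the component itself and has level [m], if [m < n]. *)
Definition level k (g : seq 'I_n -> int) := if odd k then boundary g else g.

(** On alternating functions of degree [size u] this is an embedding into the group
    ring: its values are the elements that depend only on the images of the letters
    of [u], in an alternating way. *)
Definition spread (u : seq 'I_n) (g : seq 'I_n -> int) : ZS n :=
  [ffun s : 'S_n => g (map s u)].

Lemma zs_mulE a c (u : 'S_n) : (a * c) u = \sum_(s : 'S_n) a s * c (u * s^-1)%g.
Proof. exact: ffunE. Qed.

Lemma symbol_lin (x : int) a c t :
  symbol (a *~ x + c) t = x * symbol a t + symbol c t.
Proof.
rewrite /symbol mulr_sumr -big_split; apply: eq_bigr => s _ /=.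
rewrite [X in X * _]ffunE ffunMzE -mulrzr; ring.
Qed.

(** Equivariance: left multiplication in the group ring renames the variables. *)
Lemma symbolM a c t :
  symbol (a * c) t = \sum_(s : 'S_n) a s * symbol c (map s^-1%g t).
Proof.
rewrite /symbol; under eq_bigr => u _ do rewrite zs_mulE mulr_suml.
rewrite exchange_big /=; apply: eq_bigr => s _.
rewrite (reindex_inj (mulIg s)) /= mulr_sumr; apply: eq_bigr => v _.
rewrite mulgK mulrA; congr (_ * _).
have -> : map (v * s)%g (enum 'I_n) = map s (map v (enum 'I_n)).
  by rewrite -map_comp; apply: eq_map => i /=; rewrite permM.
by rewrite -[t in LHS](mapK (permKV s)) grow_map //; apply: perm_inj.
Qed.

Lemma boundary_act (a : ZS n) g t :
  boundary (fun u => \sum_(s : 'S_n) a s * g (map s^-1%g u)) t =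
  \sum_(s : 'S_n) a s * boundary g (map s^-1%g t).
Proof.
rewrite /boundary exchange_big /=; apply: eq_bigr => s _.
rewrite -mulr_sumr (reindex_inj (@perm_inj _ s)) /=; congr (_ * _).
by apply: eq_bigr => j _; rewrite permK.
Qed.

Lemma level_symbolM k a c t : level k (symbol (a * c)) t =
  \sum_(s : 'S_n) a s * level k (symbol c) (map s^-1%g t).
Proof.
rewrite /level; case: odd; last exact: symbolM.
by rewrite (funext (symbolM a c)) boundary_act.
Qed.

Lemma level_symbol_lin k (x : int) a c t : level k (symbol (a *~ x + c)) t =
  x * level k (symbol a) t + level k (symbol c) t.
Proof.
rewrite /level; case: odd; last exact: symbol_lin.
by rewrite (funext (symbol_lin _ _ _)) boundaryD boundaryZ.
Qed.

Lemma spreadM a u g : a * spread u g =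
  spread u (fun t => \sum_(s : 'S_n) a s * g (map s^-1%g t)).
Proof.
apply/ffunP => v; rewrite zs_mulE ffunE; apply: eq_bigr => s _.
rewrite ffunE -map_comp; congr (_ * g _); apply: eq_map => i /=.
by rewrite permM.
Qed.

Lemma symbol_delta s t :
  symbol [ffun u => (u == s)%:R] t = grow (map s (enum 'I_n)) (@unit_form _) t.
Proof.
rewrite /symbol (bigD1 s) //= ffunE eqxx mul1r big1 ?addr0 // => u /negPf us.
by rewrite ffunE us mul0r.
Qed.

Lemma symbol_decomposition c :
  exists2 f, pair_lattice f & symbol c = grow (enum 'I_n) f.
Proof.
have [f Ef fE] := grow_combination c (@perm_map_enum n).
by exists f => //; apply: funext => t; rewrite -fE.
Qed.

Lemma symbol_alternating c : alternating (symbol c).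
Proof. by have [f [Af _] ->] := symbol_decomposition c; apply: grow_alternating. Qed.

(** Divisibility treats both characteristics at once, being equality to 0 when
    [l = 0]. *)
Definition vanish_below l k c :=
  forall j t, (j < k)%N -> size t = j -> (l %| level j (symbol c) t)%Z.

End Words.

(** * The layers of the lattice of symbols *)

Lemma dvdz_pow2 (l p : nat) (x : int) : odd l \/ l = 0%N ->
  (l%:Z %| 2 ^+ p * x)%Z -> (l%:Z %| x)%Z.
Proof.
case=> [ol|->]; last first.
  by rewrite !dvd0z mulf_eq0 expf_eq0 /= andbF.
by rewrite Gauss_dvdzr // coprimezXr // coprimezE /= coprimen2.
Qed.

Section Lattice.
Variables (n l : nat).
Implicit Types (c : ZS n) (t : seq 'I_n) (f h : seq 'I_n -> int).

(** Let [m] be the even degree that carries level [k], so [k] is [m - 1] or [m]. By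
    [grow_combination] the component of degree [m] of the symbol is
    [2 ^ (m / 2) y] modulo [l], because the lower even degrees vanish modulo [l]. At
    level [m - 1] one takes boundaries. At level [m] the boundary of [y] vanishes
    modulo [l], the power of 2 being cancelled, so that [y] is itself a boundary
    modulo [l]. *)
Lemma level_structure (x0 : 'I_n) k c :
  odd l \/ l = 0%N -> vanish_below l k c ->
  exists h h', [/\ alternating h, alternating h' &
    forall t, size t = k ->
      level k (symbol c) t = 2 ^+ uphalf k * boundary h t + l%:Z * h' t].
Proof.
move=> l_odd cN; have [f Ef cf] := symbol_decomposition c; have [Af df] := Ef.
(* The even degree that carries level k. *)
pose m := (uphalf k).*2.
have low t : (size t < m)%N -> (l%:Z %| f t)%Z.
  apply: (pair_lattice_low (r := enum 'I_n)) => // {}t tm ot; rewrite -cf.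
  have tk : (size t < k)%N.
    by move: tm ot; rewrite /m; lia.
  by have := cN _ t tk erefl; rewrite /level (negPf ot).
have [y Ay yE] : exists2 y, alternating y &
    forall t, size t = m -> f t = 2 ^+ uphalf k * y t.
  apply: alternating_divides => // t st.
  by have := df t; rewrite st odd_double doubleK.
have [z Az zE] : exists2 z, alternating z &
    forall t, size t = m -> symbol c t - f t = l%:Z * z t.
  apply: alternating_divides => [u i j v|t st].
    by rewrite (symbol_alternating c) Af opprD.
  by rewrite cf; apply: (@grow_dvd _ _ _ m) => //; rewrite st.
have cE t : size t = m -> symbol c t = 2 ^+ uphalf k * y t + l%:Z * z t.
  by move=> st; rewrite -yE // -zE // addrC subrK.
have bE t : (size t).+1 = m -> boundary (symbol c) t =
    2 ^+ uphalf k * boundary y t + l%:Z * boundary z t.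
  move=> st; rewrite -!boundaryZ -boundaryD.
  by apply: (@eq_boundary _ (size t)) => // u su; apply: cE; rewrite su.
case: (boolP (odd k)) => ok.
  have mk : m = k.+1 by move: ok; rewrite /m; lia.
  exists y, (boundary z); split=> // [|t st]; first exact: boundary_alternating.
  by rewrite /level ok bE // st mk.
have mk : m = k by move: ok; rewrite /m; lia.
have [t st|h [h' [Ah Ah' hE]]] := @boundary_exact_mod _ x0 l m y Ay.
  apply: (@dvdz_pow2 _ (uphalf k)) => //.
  rewrite -[_ * _](addrK (l%:Z * boundary z t)) -bE //.
  apply: dvdzB; last exact: dvdz_mulr.
  have tk : (size t < k)%N by rewrite -mk -st.
  have := cN _ t tk erefl; rewrite /level.
  by have := odd_double (uphalf k); rewrite -/m -st /= => /negbFE ->.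
exists h, (fun t => 2 ^+ uphalf k * h' t + z t); split=> // [u i j v|t st].
  by rewrite Ah' Az; ring.
by rewrite /level (negPf ok) cE ?mk // hE ?mk //; ring.
Qed.

(** The commutators of [blade_commutator] reach each [2 ^ p v_t], and the [v_t]
    span. *)
Lemma symbol_realizes p f : alternating f ->
  exists c, (forall t, (size t < p.*2)%N -> symbol c t = 0) /\
            (forall t, size t = p.*2 -> symbol c t = 2 ^+ p * f t).
Proof.
pose K g := exists c, (forall t, (size t < p.*2)%N -> symbol c t = 0) /\
  (forall t, size t = p.*2 -> symbol c t = 2 ^+ p * g t).
move=> Af; suff : K f by [].
apply: (@alternating_span _ K (enum 'I_n) p.*2 f) => //; rewrite {}/K; last first.
- by move=> i t; rewrite mem_enum.
- exact: enum_uniq.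
- move=> t ut _ st; have [u tu] := perm_eq_complete ut.
  have [c cE] : exists c, symbol c = fun s => 2 ^+ p * blade t (grow u (@unit_form _)) s.
    apply: (blade_commutator (K := fun g => exists c, symbol c = g) _ _ st tu).
      move=> _ _ [a <-] [b <-]; exists (b *~ (-1) + a).
      by apply: funext => s; rewrite symbol_lin; ring.
    move=> w /perm_eq_enum[s ->]; exists [ffun v => (v == s)%:R].
    by apply: funext => v; rewrite symbol_delta.
  exists c; rewrite cE; split=> s ss.
    by rewrite blade_grow_low ?mulr0 // st.
  by rewrite blade_grow_top // st.
- by exists 0; split=> t _; rewrite ?mulr0 /symbol big1 // => s _; rewrite ffunE mul0r.
- move=> x g g' [a [a0 aE]] [b [b0 bE]]; exists (a *~ x + b).
  by split=> t st; rewrite symbol_lin; [rewrite a0 ?b0 | rewrite aE ?bE] => //; ring.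
by move=> g g' [a [a0 aE]] gg'; exists a; split=> // t st; rewrite -gg' ?aE.
Qed.

(** At an even level the form to realize is [boundary h]; the level just below then
    vanishes because a boundary is closed. *)
Lemma level_realizes k h : alternating h -> exists2 c, vanish_below 0 k c &
  forall t, size t = k -> level k (symbol c) t = 2 ^+ uphalf k * boundary h t.
Proof.
move=> Ah; case: (boolP (odd k)) => ok.
  have mk : (uphalf k).*2 = k.+1 by move: ok; lia.
  have [c [c0 cE]] := symbol_realizes (uphalf k) Ah; rewrite mk in c0 cE.
  exists c => [j t jk tj|t st]; rewrite /level.
    rewrite dvd0z; case: odd; last by rewrite c0 // tj ltnW.
    by rewrite /boundary big1 // => i _; rewrite c0 //= tj ltnS.
  rewrite ok -boundaryZ; apply: (@eq_boundary _ k) => // u su; exact: cE.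
have mk : (uphalf k).*2 = k by move: ok; lia.
have [c [c0 cE]] := symbol_realizes (uphalf k) (boundary_alternating Ah).
rewrite mk in c0 cE.
exists c => [j t jk tj|t st]; rewrite /level; last by rewrite (negPf ok) cE.
rewrite dvd0z; case: ifP => oj; last by rewrite c0 // tj.
have [jk'|] := ltnP j.+1 k.
  by rewrite /boundary big1 // => i _; rewrite c0 //= tj.
(* Only level k - 1 is left: it is the boundary of a boundary. *)
move=> kj; have kE : k = j.+1 by apply/eqP; rewrite eqn_leq kj jk.
rewrite (@eq_boundary _ j _ (fun t => 2 ^+ uphalf k * boundary h t)) //.
  by rewrite boundaryZ boundary_boundary ?mulr0.
by move=> u su; apply: cE; rewrite su.
Qed.

(** Boundaries form a pure sublattice: if [l z] is a boundary and [l] is nonzero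
    then [z] is closed, hence a boundary by exactness. *)
Lemma boundary_divides (x0 : 'I_n) k h : alternating h ->
    (forall t, size t = k -> (l%:Z %| boundary h t)%Z) ->
  exists2 h', alternating h' &
    forall t, size t = k -> boundary h t = l%:Z * boundary h' t.
Proof.
move=> Ah dh; have Abh := boundary_alternating Ah.
have [z Az zE] := alternating_divides Abh dh.
have [l0|l0] := eqVneq l 0%N.
  exists z => // t st; rewrite l0 mul0r; apply/eqP; rewrite -dvd0z.
  by have := dh t st; rewrite l0.
have [t st|h' [? [Ah' _ h'E]]] := @boundary_exact_mod _ x0 0 k z Az.
  rewrite dvd0z; have : l%:Z * boundary z t = 0.
    rewrite -boundaryZ -[RHS](boundary_boundary t Ah).
    by apply: (@eq_boundary _ (size t)) => // u su; rewrite zE // su.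
  by move/eqP; rewrite mulf_eq0 /= (negPf l0 : (l%:Z == 0) = false).
by exists h' => // t st; rewrite zE // h'E // mul0r addr0.
Qed.

(** The levels below [n] see all even degrees: those below [n] directly, degree [n]
    through its boundary, which is injective there as there are no forms of degree
    [n + 1]. The even degrees control the odd ones by [pair_lattice_low]. *)
Lemma vanish_belowP (x0 : 'I_n) c :
  vanish_below l n c <-> forall t, (l%:Z %| symbol c t)%Z.
Proof.
split=> [cN|cl j t _ _]; last first.
  by rewrite /level; case: odd => //; apply: rpred_sum => i _; apply: cl.
have Ac := symbol_alternating c.
have large t : (n < size t)%N -> symbol c t = 0.
  move=> nt; apply: alternating_not_uniq => //; apply: contraTN nt => ut.
  by have := max_card (mem t); rewrite card_ord (card_uniqP ut) leqNgt.
have top t : size t = n -> ~~ odd n -> (l%:Z %| symbol c t)%Z.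
  move=> st on; have -> : symbol c t = wedge x0 (boundary (symbol c)) t.
    apply/eqP; rewrite -subr_eq0 -boundary_wedge.
    rewrite /boundary big1 // => j _.
    apply: alternating_not_uniq; first exact: wedge_alternating.
    apply/negP => /card_uniqP; have := max_card (mem (j :: t)).
    by rewrite card_ord => + jt; rewrite jt /= st ltnn.
  case: t st => [|i t] st; first by rewrite dvdz0.
  apply: (@wedge_dvd _ _ _ (size t)) => // u su.
  have nu : (size u).+1 = n by rewrite -[RHS]st /= su.
  have un : (size u < n)%N by rewrite -[X in (_ < X)%N]nu.
  have ou : odd (size u) by move: on; rewrite -[X in odd X]nu /= negbK.
  by have := cN _ u un erefl; rewrite /level ou.
have [f Ef cf] := symbol_decomposition c.
have fl t : (l%:Z %| f t)%Z.
  apply: (@pair_lattice_low _ (enum 'I_n) f (size t).+1 l Ef) => // u _ ou.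
  rewrite -cf; have [nu|un|un] := ltngtP n (size u).
  - by rewrite large.
  - by have := cN _ u un erefl; rewrite /level (negPf ou).
  by apply: top => //; rewrite un.
move=> t; rewrite cf -[grow _ f t](subrK (f t)); apply: dvdzD => //.
exact: (@grow_dvd _ _ _ (size t)).
Qed.
End Lattice.

(** * Specht modules of hooks *)

Section HookTableau.
Variables (n k : nat) (T : tableau n (hook n k)).
Hypothesis lt_kn : (k < n)%N.

Lemma hook_box i : ((T i).1 <= k)%N /\ ((T i).1 = 0%N \/ (T i).2 = 0%N).
Proof.
have : diagram (hook n k) (T i) by apply/box_diagram; exists i.
rewrite /diagram /= size_nseq ltnS => /andP[-> rc]; split=> //.
case: (T i) rc => -[|r] c /=; first by left.
by rewrite nth_nseq; case: ifP => _; case: c => //; right.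
Qed.

Lemma hook_column : exists col, map T col = mkseq (fun p => (p, 0%N)) k.+1.
Proof.
have /choice[f fE] : forall p : 'I_k.+1, exists i, T i = (val p, 0%N).
  move=> [[|p] pk]; apply/box_diagram; rewrite /diagram /=.
    by rewrite subn_gt0.
  by have pk' : (p < k)%N := pk; rewrite size_nseq nth_nseq ltnS pk'.
exists (map f (enum 'I_k.+1)); rewrite -map_comp /mkseq -val_enum_ord -map_comp.
exact: eq_map.
Qed.

(* The first column, read downwards from the corner [i0]. *)
Variables (i0 : 'I_n) (leg : seq 'I_n).
Hypothesis colE : map T (i0 :: leg) = mkseq (fun p => (p, 0%N)) k.+1.

Lemma size_leg : size leg = k.
Proof. by have := congr1 size colE; rewrite size_mkseq size_map => -[]. Qed.

Lemma col_uniq : uniq (i0 :: leg).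
Proof.
apply: (@map_uniq _ _ T); rewrite colE mkseq_uniq //.
by move=> p q [].
Qed.

Lemma mem_col i : (i \in i0 :: leg) = ((T i).2 == 0%N).
Proof.
rewrite -(mem_map (@box_inj _ _ T)) colE; apply/mapP/eqP => [[p _ ->]//|Ti0].
exists (T i).1; last by rewrite -Ti0 -surjective_pairing.
by rewrite mem_iota add0n ltnS; case: (hook_box i).
Qed.

Lemma mem_leg i : (i \in leg) = ((T i).1 != 0%N).
Proof.
have [Ti0 legE] : T i0 = (0, 0)%N /\ map T leg = [seq (p, 0%N) | p <- iota 1 k].
  by case: colE.
rewrite -(mem_map (@box_inj _ _ T)) legE; apply/mapP/idP => [[p]|Ti].
  by rewrite mem_iota => /andP[p0 _] ->; rewrite -lt0n.
exists (T i).1; first by rewrite mem_iota add1n ltnS lt0n Ti; case: (hook_box i).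
have [_ [/eqP|Tz]] := hook_box i; first by rewrite (negPf Ti).
by rewrite -Tz -surjective_pairing.
Qed.

(** The letters outside the leg are those of the first row, all other rows being
    singletons; so stabilizing the rows means fixing the leg pointwise. *)
Lemma row_stab_leg (s : 'S_n) : (s \in row_stab T) = (map s leg == leg).
Proof.
rewrite inE; apply/forallP/eqP => [rs|sl i].
  rewrite -[RHS]map_id; apply/eq_in_map => i il /=; apply: (@box_inj _ _ T).
  have /eqP Es := rs i; have l1 : (T i).1 != 0%N by rewrite -mem_leg.
  have [_ [/eqP|Ti2]] := hook_box i; first by rewrite (negPf l1).
  have [_ [/eqP|Ts2]] := hook_box (s i); first by rewrite Es (negPf l1).
  by rewrite [T (s i)]surjective_pairing Es Ts2 -Ti2 -surjective_pairing.
have fix_s : {in leg, forall j, s j = j}.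
  by apply/eq_in_map; rewrite map_id.
case: (boolP (i \in leg)) => il; first by rewrite fix_s.
have : s i \notin leg.
  by apply: contra il => sil; rewrite -(perm_inj (fix_s _ sil)).
by move: il; rewrite !mem_leg !negbK => /eqP -> /eqP ->.
Qed.

Lemma col_stab_fix (s : 'S_n) i : s \in col_stab T -> i \notin i0 :: leg -> s i = i.
Proof.
rewrite inE => /forallP/(_ i)/eqP Es; rewrite mem_col => Ti.
have [_ [Ti1|/eqP]] := hook_box i; last by rewrite (negPf Ti).
have [_ [Ts1|/eqP]] := hook_box (s i); last by rewrite Es (negPf Ti).
by apply: (@box_inj _ _ T); rewrite [LHS]surjective_pairing [RHS]surjective_pairing Es Ti1 Ts1.
Qed.

Lemma col_stab_mem (s : 'S_n) i : s \in col_stab T ->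
  (s i \in i0 :: leg) = (i \in i0 :: leg).
Proof. by rewrite inE => /forallP/(_ i)/eqP Es; rewrite !mem_col Es. Qed.

Lemma col_stab_tperm (s : 'S_n) a b : a \in i0 :: leg -> b \in i0 :: leg ->
  (tperm a b * s \in col_stab T)%g = (s \in col_stab T).
Proof.
rewrite !mem_col => /eqP Ta /eqP Tb.
have T_tperm i : (T (tperm a b i)).2 = (T i).2.
  by case: tpermP => [->|->|//]; rewrite Ta Tb.
rewrite !inE; apply/forallP/forallP => cs i; apply/eqP.
  by have /eqP := cs (tperm a b i); rewrite permM tpermK T_tperm.
by have /eqP := cs (tperm a b i); rewrite permM T_tperm.
Qed.

Definition column_form (t : seq 'I_n) : int :=
  \sum_(s in col_stab T) (-1) ^+ odd_perm s * (map s (i0 :: leg) == t)%:R.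

(** Exchanging two adjacent letters of the word amounts to composing with a
    transposition of the column, which changes the sign. *)
Lemma column_form_alternating : alternating column_form.
Proof.
move=> u i j v; rewrite /column_form.
have [su|su] := ltnP (size u).+1 (size (i0 :: leg)); last first.
  rewrite !big1 ?oppr0 // => s _; rewrite (_ : _ == _ = false) ?mulr0 //;
  apply/negP => /eqP/(congr1 size); rewrite size_map size_cat /=; move: su => /=; lia.
set c := i0 :: leg in su *; set a := nth i0 c (size u); set b := nth i0 c (size u).+1.
have ab : a != b.
  by rewrite /a /b (nth_uniq _ (ltnW su) su col_uniq) neq_ltn ltnSn.
have ac : a \in c by exact: (mem_nth i0 (ltnW su)).
have bc : b \in c by exact: (mem_nth i0 su).
rewrite (reindex_inj (mulgI (tperm a b))) -sumrN; apply: eq_big => s.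
  by rewrite col_stab_tperm.
move=> _; rewrite odd_permM odd_tperm ab addTb signrN mulNr; congr (- (_ * _%:R)).
have cE : c = take (size u) c ++ a :: b :: drop (size u).+2 c.
  by rewrite -(drop_nth i0 su) -(drop_nth i0 (ltnW su)) cat_take_drop.
have out x : x \in take (size u) c ++ drop (size u).+2 c -> tperm a b x = x.
  have : uniq (a :: b :: take (size u) c ++ drop (size u).+2 c).
    by rewrite -(perm_uniq (permEl (perm_catCA _ [:: a; b] _))) -cE; apply: col_uniq.
  rewrite !cons_uniq inE negb_or => /and3P[/andP[_ an] bn _] xt.
  by rewrite tpermD //; [move: an | move: bn]; apply: contraNneq => ->.
rewrite cE !map_cat /= !permM tpermL tpermR.
have mE w : {subset w <= take (size u) c ++ drop (size u).+2 c} ->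
    map (tperm a b * s)%g w = map s w.
  by move=> wX; apply/eq_in_map => x /wX/out tx; rewrite permM tx.
rewrite !mE; last 2 first.
- by move=> x xd; rewrite mem_cat xd orbT.
- by move=> x xd; rewrite mem_cat xd.
have st : size (take (size u) c) = size u by rewrite size_takel // ltnW // ltnW.
rewrite !eqseq_cat ?size_map //=.
by rewrite !eqseq_cons; do !case: eqP => //=.
Qed.

(** Both functions are alternating, are supported on the rearrangements of the
    column, and take the value 1 at the column. *)
Lemma column_form_blade : column_form = blade (i0 :: leg) (@unit_form _).
Proof.
have Ab := blade_alternating (i0 :: leg) (@unit_form_alternating 'I_n).
have ucol := col_uniq.
apply: funext => t; case: (boolP (perm_eq t (i0 :: leg))) => [tc|ntc].
  apply: (alternating_perm_eq column_form_alternating Ab tc).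
  rewrite blade_self // /column_form (bigD1 1%g) /=; last first.
    by rewrite inE; apply/forallP => i; rewrite perm1.
  rewrite odd_perm1 mul1r (_ : map (1%g : 'S_n) (i0 :: leg) == _); last first.
    by apply/eqP; apply: map_id_in => i _; rewrite perm1.
  rewrite big1 ?addr0 // => s /andP[cs s1]; case: eqP => [sE|]; last by rewrite mulr0.
  case/negP: s1; apply/eqP/permP => i; rewrite perm1.
  case: (boolP (i \in i0 :: leg)) => [ic|]; last exact: col_stab_fix.
  have /eq_in_map : map s (i0 :: leg) = map id (i0 :: leg) by rewrite map_id.
  exact.
transitivity (0 : int).
  rewrite /column_form big1 // => s cs; case: eqP => [sE|]; last by rewrite mulr0.
  case/negP: ntc; rewrite -sE; apply: uniq_perm => //.
    by rewrite (map_inj_uniq (@perm_inj _ s)).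
  move=> i; rewrite -[i](permKV s) (mem_map (@perm_inj _ s)) -(col_stab_mem _ cs).
  by rewrite permKV.
apply/esym/eqP; apply: contraNT ntc => bt.
have st : size t = size (i0 :: leg).
  by apply/eqP; apply: contraNT bt => /blade_size ->.
have ut : uniq t by apply: contraNT bt => /(alternating_not_uniq Ab) ->.
apply: uniq_perm => //; apply: (uniq_min_size ut _ _).2; last by rewrite st.
move=> i it; apply: contraNT bt => ic.
by rewrite (blade_notin ic it).
Qed.

(** Multiplying by the row symmetrizer forgets the image of the corner, and summing
    over that image is the boundary. *)
Lemma hook_symmetrizer :
  col_antisym T * row_sym T = spread leg (boundary column_form).
Proof.
apply/ffunP => u; rewrite zs_mulE ffunE /boundary /column_form exchange_big /=.
rewrite [RHS]big_mkcond /=; apply: eq_bigr => s _; rewrite !ffunE.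
case: ifP => cs; last by rewrite mul0r.
rewrite -mulr_sumr; congr (_ * _); rewrite row_stab_leg.
rewrite (bigD1 (s i0)) //= big1 => [|j /negPf js]; last first.
  by rewrite eqseq_cons eq_sym js.
rewrite addr0 eqseq_cons eqxx /=; congr ((nat_of_bool _)%:R); rewrite eq_sym.
rewrite (_ : map (u * s^-1)%g leg = map s^-1%g (map u leg)); last first.
  by rewrite -map_comp; apply: eq_map => i /=; rewrite permM.
apply/eqP/eqP => [e|e]; first by rewrite [in LHS]e (mapK (permKV s)).
by rewrite -e (mapK (permK s)).
Qed.

End HookTableau.

Section SpechtForms.
Variables (n k : nat) (T : tableau n (hook n k)).
Hypothesis lt_kn : (k < n)%N.

Lemma eq_spread (u : seq 'I_n) f g : (forall t, size t = size u -> f t = g t) ->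
  spread u f = spread u g.
Proof. by move=> fg; apply/ffunP => s; rewrite !ffunE fg ?size_map. Qed.

Lemma spread_lin (u : seq 'I_n) (x : int) (f g : seq 'I_n -> int) :
  spread u (fun t => x * f t + g t) = spread u f *~ x + spread u g.
Proof. by apply/ffunP => s; rewrite !ffunE ffunMzE !ffunE mulrzz (mulrC x). Qed.

Lemma spread_dvd (u t : seq 'I_n) (d : int) f : alternating f -> uniq u ->
    (forall s : 'S_n, (d %| spread u f s)%Z) ->
  size t = size u -> (d %| f t)%Z.
Proof.
move=> Af uu df tu; case: (boolP (uniq t)) => [ut|/(alternating_not_uniq Af) ->].
  have [s <-] := perm_extension uu ut (esym tu).
  by have := df s; rewrite ffunE.
exact: dvdz0.
Qed.

(** The generator of the Specht module is the boundary of [v_col], for the first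
    column [col]; its translates are the boundaries of the [v_t], and the [v_t] span
    all alternating functions. *)
Lemma spechtP : exists leg : seq 'I_n, [/\ size leg = k, uniq leg &
  forall x : ZS n, x \in specht T <->
    exists2 h, alternating h & x = spread leg (boundary h)].
Proof.
have [[|i0 leg] colE] := hook_column T lt_kn; first by have := congr1 size colE.
have sleg := size_leg colE; have ucol := col_uniq colE.
exists leg; split=> //; first by case/andP: ucol.
have symE := hook_symmetrizer colE.
have formE := column_form_blade lt_kn colE; have formA := column_form_alternating lt_kn colE.
move=> x; split=> [/asboolP[c ->]|[h Ah ->]].
  exists (fun t => \sum_(s : 'S_n) c s * column_form T i0 leg (map s^-1%g t)).
    move=> u i j v; rewrite -sumrN; apply: eq_bigr => s _.
    by rewrite !map_cat /= formA mulrN.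
  by rewrite symE spreadM; apply: eq_spread => t _; rewrite boundary_act.
pose K h := spread leg (boundary h) \in specht T.
suff : K h by [].
apply: (@alternating_span _ K (enum 'I_n) k.+1 h) => //; rewrite {}/K.
- move=> g g' Kg gg'; suff <- : spread leg (boundary g) = spread leg (boundary g') by [].
  by apply: eq_spread; rewrite sleg; apply: eq_boundary.
- move=> a g g' Kg Kg'.
  have := @rpredD (ZS n)^o (specht T) _ _ (@rpredMz (ZS n)^o (specht T) a _ Kg) Kg'.
  rewrite -spread_lin; suff -> : boundary (fun t => a * g t + g' t) =
    fun t => a * boundary g t + boundary g' t by [].
  by apply: funext => t; rewrite boundaryD boundaryZ.
- rewrite (_ : spread _ _ = 0); first exact: (@rpred0 (ZS n)^o (specht T)).
  by apply/ffunP => s; rewrite !ffunE /boundary big1.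
- move=> t ut _ st; have [s tE] : exists s : 'S_n, map s (i0 :: leg) = t.
    by apply: perm_extension => //; rewrite /= sleg st.
  apply/asboolP; exists [ffun v => (v == s)%:R].
  rewrite symE spreadM; apply: eq_spread => u _.
  rewrite (bigD1 s) //= ffunE eqxx mul1r big1 ?addr0 => [|v /negPf vs]; last first.
    by rewrite ffunE vs mul0r.
  rewrite /boundary (reindex_inj (@perm_inj _ s)) /=; apply: eq_bigr => j _.
  rewrite formE -tE -[in LHS](mapK (permKV s) u).
  exact: (@blade_map _ _ s (i0 :: leg) (j :: map s^-1%g u) (@perm_inj _ s)).
- exact: enum_uniq.
by move=> i t; rewrite mem_enum.
Qed.
End SpechtForms.

(** * Evaluation in an algebra with even and odd parts *)

Section Expansion.
Variables (A : pzRingType) (T : eqType) (p q : T -> A).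
Implicit Types (g : seq T -> int) (r w t : seq T).

(** Sum over the subwords [t] of [r] of [g t] times the product along [r] of [q] at
    the letters of [t] and [p] at the others: the value, at [x_i = p_i + q_i], of a
    polynomial with symbol [g]. *)
Fixpoint expand r g : A :=
  if r is x :: r' then p x * expand r' g + q x * expand r' (fun t => g (x :: t))
  else (g [::])%:~R.

Lemma eq_expand r f g : (forall t, {subset t <= r} -> f t = g t) ->
  expand r f = expand r g.
Proof.
elim: r f g => [|x r IH] f g fg /=; first by rewrite fg.
rewrite (IH f g) => [|t tr]; last by apply: fg => i /tr ir; rewrite inE ir orbT.
congr (_ + _ * _); apply: IH => t tr; apply: fg => i.
by rewrite !inE => /orP[->//|/tr ->]; rewrite orbT.
Qed.

Lemma expand_sum (J : finType) (c : J -> int) (g : J -> seq T -> int) r :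
  expand r (fun t => \sum_k c k * g k t) = \sum_k expand r (g k) *~ c k.
Proof.
elim: r g => [|x r IH] g /=.
  by rewrite rmorph_sum /=; apply: eq_bigr => k _; rewrite rmorphM /= mulrzl.
rewrite !IH !mulr_sumr -big_split /=; apply: eq_bigr => k _.
by rewrite mulrzDl !mulrzAr.
Qed.

Lemma expand_dvd (l : nat) r g : l%:R = 0 :> A ->
  (forall t, (l%:Z %| g t)%Z) -> expand r g = 0.
Proof.
move=> lA; elim: r g => [|x r IH] g lg /=; last by rewrite !IH ?mulr0 ?addr0.
by have /dvdzP[m ->] := lg [::]; rewrite rmorphM /= -pmulrn lA mulr0.
Qed.

Lemma expand_grow r : uniq r -> expand r (grow r (@unit_form T)) = \prod_(x <- r) (p x + q x).
Proof.
elim: r => [|x r IH] /=; first by rewrite big_nil.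
case/andP=> xr ur; rewrite big_cons -IH // mulrDl; congr (_ * _ + _ * _).
  apply: eq_expand => t tr; rewrite wedge_out ?addr0 //.
  by apply: contra xr => /tr.
apply: eq_expand => t tr /=; rewrite eqxx (grow_notin xr) ?mem_head // add0r.
rewrite (_ : (fun u => _) = fun=> 0) ?wedge0 ?subr0 //.
by apply: funext => u; rewrite (grow_notin xr) ?mem_head.
Qed.

Hypothesis pC : forall x y, p x * p y = p y * p x.
Hypothesis pqC : forall x y, p x * q y = q y * p x.
Hypothesis qC : forall x y, q x * q y = - (q y * q x).

Lemma expandN r g : expand r (fun t => - g t) = - expand r g.
Proof.
elim: r g => [|x r IH] g /=; first by rewrite rmorphN.
by rewrite !IH !mulrN opprD.
Qed.

(** Reordering the odd factors [q] produces the same sign as reordering the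
    arguments of [g]. *)
Lemma expand_perm r r' g : alternating g -> perm_eq r r' -> expand r g = expand r' g.
Proof.
move=> Ag rr'; elim/perm_adjacent_ind: rr' g Ag => // [u v w IH1 IH2 g Ag|].
  by rewrite IH1 ?IH2.
elim=> [|z u IH] x y v g Ag /=; last first.
  by rewrite (IH _ _ _ g Ag) (IH _ _ _ _ (alternating_cons z Ag)).
have -> : (fun t => g [:: x, y & t]) = fun t => - g [:: y, x & t].
  by apply: funext => t; apply: (Ag [::]).
rewrite expandN !mulrDr !mulrA (pC x y) !pqC (qC x y) !mulrN !mulNr opprK.
by rewrite -!addrA; congr (_ + _); rewrite addrCA.
Qed.

(** The order of the factors enters the right-hand side only through the symbol of
    the word [w]; the other operand [r] stays fixed. *)
Lemma prod_expand r w : uniq r -> perm_eq w r ->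
  \prod_(x <- w) (p x + q x) = expand r (grow w (@unit_form T)).
Proof.
move=> ur wr; rewrite -(expand_perm _ wr); last first.
  exact/grow_alternating/unit_form_alternating.
by rewrite expand_grow // (perm_uniq wr).
Qed.
End Expansion.

(** The substitution [q] on [t] and 1 elsewhere isolates one coefficient of [g]. *)
Lemma expand_extract (A : pzRingType) (T : eqType) (p q : T -> A) t u g :
    (forall x, x \in t -> p x = 0) ->
    (forall x, x \in u -> p x = 1 /\ q x = 0) ->
  expand p q (t ++ u) g = (\prod_(x <- t) q x) *~ g t.
Proof.
move=> pt pu; elim: t g pt => [|x t IH] g pt /=.
  rewrite big_nil; elim: u pu => //= x u IH pu.
  have [-> ->] := pu x (mem_head _ _).
  rewrite mul1r mul0r addr0 IH // => y yu; apply: pu.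
  by rewrite inE yu orbT.
rewrite pt ?mem_head // mul0r add0r IH ?big_cons ?mulrzAr // => y yt.
by apply: pt; rewrite inE yt orbT.
Qed.

Lemma anticomm_prod (A : pzRingType) (e : nat -> A) (u w : seq nat) :
    (forall i j, e i * e j = - (e j * e i)) ->
  (\prod_(i <- u) e i) * (\prod_(i <- w) e i) =
  (-1) ^+ (odd (size u) && odd (size w)) * ((\prod_(i <- w) e i) * (\prod_(i <- u) e i)).
Proof.
move=> eC; have letter i v : e i * \prod_(j <- v) e j =
    (-1) ^+ odd (size v) * (\prod_(j <- v) e j * e i).
  elim: v => [|j v IH] /=; first by rewrite big_nil mulr1 expr0 !mul1r.
  rewrite !big_cons mulrA eC mulNr -mulrA IH signrN mulNr; congr (- _).
  by rewrite !mulrA commr_sign.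
elim: u => [|i u IH]; first by rewrite !big_nil mulr1 expr0 !mul1r.
rewrite !big_cons -mulrA IH /= [LHS]mulrA commr_sign -[LHS]mulrA [e i * (_ * _)]mulrA letter.
rewrite !mulrA -signr_addb.
by case: (odd _) (odd _) => -[].
Qed.

(** * Torsion and parity in the Grassmann algebra *)

Section Grassmann.
Variable R : comPzRingType.
Local Notation G := (grassmann R).

Definition term (a : R) (w : word) : free_alg R := << a *g w >>.

Lemma termM a b (u w : word) : term a u * term b w = term (a * b) (u ++ w).
Proof. exact: ma_mulUU. Qed.

Lemma term_sum (f : free_alg R) :
  exists s : seq (R * word), f = \sum_(k <- s) term k.1 k.2.
Proof.
exists [seq (f@_w, w) | w <- msupp f]; rewrite big_map; exact: monalgE.
Qed.

Lemma pi0 : \pi_G (0 : free_alg R) = 0.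
Proof. by apply: (addrI (\pi_G (0 : free_alg R))); rewrite -qr_piD !addr0. Qed.

Definition monomial (a : R) (w : word) : G := \pi_G (term a w).

Lemma monomialD (w : word) : {morph monomial^~ w : a b / a + b}.
Proof. by move=> a b; rewrite /monomial /term monalgUD qr_piD. Qed.

Lemma monomialM a b (u w : word) :
  monomial a u * monomial b w = monomial (a * b) (u ++ w).
Proof. by rewrite /monomial -termM qr_piM. Qed.

Lemma monomial1 : monomial 1 [::] = 1.
Proof. by []. Qed.

Definition generator i : G := monomial 1 [:: i].

Lemma monomialE a w : monomial a w = monomial a [::] * \prod_(i <- w) generator i.
Proof.
suff -> : \prod_(i <- w) generator i = monomial 1 w by rewrite monomialM mulr1.
elim: w => [|i w IH]; first by rewrite big_nil.
by rewrite big_cons IH monomialM mulr1.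
Qed.

Lemma grassmann_sum (x : G) :
  exists s : seq (R * word), x = \sum_(k <- s) monomial k.1 k.2.
Proof.
have [f ->] := qr_surj x; have [s ->] := term_sum f; exists s.
apply: (big_morph (fun y : free_alg R => \pi_G y)); first exact: qr_piD.
exact: pi0.
Qed.

Lemma generatorC i j : generator i * generator j = - (generator j * generator i).
Proof.
apply/eqP; rewrite -addr_eq0 !monomialM; apply/eqP.
have -> : monomial (1 * 1) ([:: i] ++ [:: j]) + monomial (1 * 1) ([:: j] ++ [:: i])
    = \pi_G (free_gen R i * free_gen R j + free_gen R j * free_gen R i).
  by rewrite qr_piD /monomial -!termM.
rewrite -pi0; apply: qr_pi_eq; rewrite subr0; apply/asboolP => I _; apply.
by exists i, j.
Qed.

Definition has_parity (b : bool) (x : G) : Prop :=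
  exists s : seq (R * word), x = \sum_(k <- s | odd (size k.2) == b) monomial k.1 k.2.

Lemma parity_split (x : G) :
  exists y : G * G, [/\ has_parity false y.1, has_parity true y.2 & x = y.1 + y.2].
Proof.
have [s ->] := grassmann_sum x.
exists (\sum_(k <- s | odd (size k.2) == false) monomial k.1 k.2,
        \sum_(k <- s | odd (size k.2) == true) monomial k.1 k.2).
split=> /=; [by exists s | by exists s |].
rewrite addrC (bigID (fun k : R * word => odd (size k.2))) /=.
by congr (_ + _); apply: eq_bigl => k; case: (odd _).
Qed.

Lemma monomialC a b (u w : word) : monomial a u * monomial b w =
  (-1) ^+ (odd (size u) && odd (size w)) * (monomial b w * monomial a u).
Proof.
rewrite !monomialM (monomialE _ (u ++ w)) (monomialE _ (w ++ u)) !big_cat /=.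
rewrite (anticomm_prod _ _ generatorC).
by rewrite [LHS]mulrA commr_sign -[LHS]mulrA (mulrC a).
Qed.

Lemma has_parity_mulC b b' x y : has_parity b x -> has_parity b' y ->
  x * y = (-1) ^+ (b && b') * (y * x).
Proof.
move=> [s ->] [s' ->]; rewrite [LHS]mulr_suml [X in _ * X]mulr_sumr mulr_sumr.
apply: eq_bigr => k /eqP <-; rewrite mulr_sumr mulr_suml mulr_sumr.
by apply: eq_bigr => j /eqP <-; apply: monomialC.
Qed.

Lemma grassmann_natr0 l : l%:R = 0 :> R -> l%:R = 0 :> G.
Proof.
move=> lR; have natE m : m%:R = monomial m%:R [::].
  elim: m => [|m IH].
    by apply: (addrI (monomial 0 [::])); rewrite -monomialD !addr0.
  by rewrite -natr1 IH -monomial1 -monomialD natr1.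
by rewrite natE lR; apply: esym (natE 0%N).
Qed.

Definition pairing (h : seq nat -> int) (f : free_alg R) : R :=
  \sum_(w <- msupp f) f@_w *~ h w.

Lemma pairing_zmod h : zmod_morphism (pairing h).
Proof.
have wide (d : {fset word}) (f : free_alg R) : (msupp f `<=` d)%fset ->
    pairing h f = \sum_(w <- d) f@_w *~ h w.
  by move=> fd; apply/big_fset_incl => // w _ /mcoeff_outdom ->; rewrite mul0rz.
move=> f g; have dE := fsubset_refl (msupp f `|` msupp g `|` msupp (f - g))%fset.
move: dE; rewrite !fsubUset => /andP[/andP[df dg] dfg].
rewrite !(wide _ _ df, wide _ _ dg, wide _ _ dfg) -sumrB; apply: eq_bigr => w _.
by rewrite mcoeffB mulrzBl.
Qed.
HB.instance Definition _ h :=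
  GRing.isZmodMorphism.Build (free_alg R) R (pairing h) (pairing_zmod h).

Lemma pairingU h a (w : word) : pairing h (term a w) = a *~ h w.
Proof. 
rewrite /pairing (big_fset_incl _ (@msuppU_le _ _ w a)) /=; last first.
  by move=> u _ /mcoeff_outdom ->; rewrite mul0rz.
by rewrite big_seq_fset1 mcoeffUU.
Qed.

(** An alternating function takes opposite values at [u i j w] and [u j i w] for all
    contexts [u] and [w], so the pairing kills the two-sided ideal generated by the
    relations. *)
Lemma pairing_ideal h (f : free_alg R) : alternating h ->
  f \in ideal_gen (@grassmann_rel R) -> pairing h f = 0.
Proof.
move=> Ah /asboolP Jf.
pose I (x : free_alg R) := forall a b : free_alg R, pairing h (a * x * b) = 0.
have /(_ 1 1) : I f.
  apply: Jf.
    split=> [a b|x y Ix Iy a b|a x b Ix a' b'].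
    - by rewrite mulr0 mul0r raddf0.
    - by rewrite mulrBr mulrBl raddfB /= Ix Iy subr0.
    by have := Ix (a' * a) (b * b'); rewrite !mulrA.
  move=> _ [i [j ->]] a b; have [s ->] := term_sum a; have [s' ->] := term_sum b.
  rewrite [X in X * _]mulr_suml mulr_suml raddf_sum big1 //= => k _.
  rewrite mulr_sumr raddf_sum big1 //= => k' _.
  have E i' j' : term k.1 k.2 * (free_gen R i' * free_gen R j') * term k'.1 k'.2
      = term (k.1 * k'.1) (k.2 ++ [:: i', j' & k'.2]).
    by rewrite -[free_gen R i']/(term 1 [:: i']) -[free_gen R j']/(term 1 [:: j'])
      !termM !mulr1 -catA.
  by rewrite mulrDr mulrDl raddfD /= !E !pairingU Ah mulrNz addNr.
by rewrite mul1r mulr1.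
Qed.

(** Pairing with the blade of [t] recovers the scalar. *)
Lemma generator_prod_torsion (t : seq nat) (m : int) : uniq t ->
  (\prod_(i <- t) generator i) *~ m = 0 -> m%:~R = 0 :> R.
Proof.
move=> ut tm.
have mz x : monomial x t *~ m = monomial (x *~ m) t.
  have mon_add : zmod_morphism (monomial^~ t).
    by move=> a b; apply/(canRL (addrK _)); rewrite -monomialD subrK.
  pose mon := GRing.isZmodMorphism.Build R G _ mon_add.
  pose mon' : {additive R -> G} := HB.pack (monomial^~ t) mon.
  exact/esym/(raddfMz mon').
have prodE : \prod_(i <- t) generator i = monomial 1 t.
  by rewrite monomialE monomial1 mul1r.
move: tm; rewrite prodE mz => tm.
have : term (1 *~ m) t \in ideal_gen (@grassmann_rel R).
  rewrite -[term _ _]subr0.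
  rewrite (Quotient.idealrBE (ideal_gen (@grassmann_rel R) : zmodClosed (free_alg R))).
  by apply/eqP; apply: etrans tm (esym pi0).
move/(pairing_ideal (blade_alternating t (@unit_form_alternating _))).
by rewrite pairingU blade_self.
Qed.
End Grassmann.

(** * Multilinear identities of the Grassmann algebra *)

Section Identities.
Variables (R : comPzRingType) (l : nat).
Hypothesis charR : is_char R l.

Lemma char_natr0 : l%:R = 0 :> R.
Proof. by move: charR; rewrite /is_char; case: eqP => [-> //|_ []]. Qed.

Lemma char_dvd (m : int) : m%:~R = 0 :> R -> (l%:Z %| m)%Z.
Proof.
have nat_dvd (k : nat) : k%:R = 0 :> R -> (l %| k)%N.
  move=> k0; move: (charR); rewrite /is_char; case: eqP => [-> lR|/eqP l0 [lR lmin]].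
    by case: k k0 => // k /eqP; rewrite (negPf (lR k.+1 isT)).
  rewrite /dvdn; apply/negPn/negP; rewrite -lt0n => kl.
  have /negP[] : (k %% l)%:R != 0 :> R by apply: lmin; rewrite kl ltn_mod lt0n.
  by move: k0; rewrite [in X in X -> _](divn_eq k l) natrD natrM lR mulr0 add0r => ->.
rewrite dvdzE; case: m => m m0; apply: nat_dvd; first exact: m0.
by apply/eqP; rewrite -oppr_eq0; apply/eqP.
Qed.

Variable n : nat.

Lemma eval_mono (A : pzRingType) (p q : nat -> A) (c : ZS n) :
    (forall x y, p x * p y = p y * p x) -> (forall x y, p x * q y = q y * p x) ->
    (forall x y, q x * q y = - (q y * q x)) ->
  eval_free (fun i => p i + q i) (\sum_(s : 'S_n) << c s *g mono_word s >> : ZX) =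
  expand (fun i : 'I_n => p i) (fun i : 'I_n => q i) (enum 'I_n) (symbol c).
Proof.
move=> pC pqC qC; rewrite raddf_sum /symbol expand_sum /=; apply: eq_bigr => s _.
rewrite eval_freeU big_map; congr (_ *~ _).
rewrite -(@prod_expand A 'I_n (fun i => p i) (fun i => q i)) ?enum_uniq //.
  by rewrite [RHS]big_map; apply: eq_bigr.
exact: perm_map_enum.
Qed.

(** An element of the Grassmann algebra is the sum of an even, hence central, part
    and an odd part, and odd parts anticommute; so every evaluation is an [expand] of
    the symbol. Conversely, substituting generators for the letters of [t] and 1 for
    the others gives the coefficient at [t] times a product of distinct
    generators. *)
Lemma Id_grassmannP (c : ZS n) : (0 < n)%N ->
  (\sum_(s : 'S_n) << c s *g mono_word s >> : ZX) \in Id (grassmann R) n <->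
  forall t, (l%:Z %| symbol c t)%Z.
Proof.
move=> n_gt0; split=> [/asboolP[_ idf] t|lc]; last first.
  apply/asboolP; split=> [|a].
    rewrite raddf_sum big1 //= => s _; rewrite mcoeffU (_ : _ == _ = false) //.
    apply/negP => /eqP/(congr1 size) /=.
    by rewrite size_map size_enum_ord => n0; rewrite n0 in n_gt0.
  have /choice[pq pqE] : forall i, exists y : grassmann R * grassmann R,
      [/\ has_parity false y.1, has_parity true y.2 & a i = y.1 + y.2].
    by move=> i; apply: parity_split.
  rewrite (_ : a = fun i => (pq i).1 + (pq i).2); last first.
    by apply: funext => i; case: (pqE i).
  rewrite (eval_mono (p := fun i => (pq i).1) (q := fun i => (pq i).2)).
  - exact: (expand_dvd _ _ _ (grassmann_natr0 char_natr0) lc).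
  - move=> x y; case: (pqE x) (pqE y) => px _ _ [py _ _].
    by rewrite (has_parity_mulC px py) mul1r.
  - move=> x y; case: (pqE x) (pqE y) => px _ _ [_ qy _].
    by rewrite (has_parity_mulC px qy) mul1r.
  move=> x y; case: (pqE x) (pqE y) => _ qx _ [_ qy _].
  by rewrite (has_parity_mulC qx qy) mulN1r.
have Ac := symbol_alternating c.
case: (boolP (uniq t)) => [ut|/(alternating_not_uniq Ac) ->]; last exact: dvdz0.
have [u tu] := perm_eq_complete ut.
pose p (i : nat) : grassmann R := (i \notin map val t)%:R.
pose q (i : nat) : grassmann R := if i \in map val t then generator R i else 0.
have pC x y : p x * p y = p y * p x.
  by rewrite /p; case: (x \in _); rewrite ?mul0r ?mulr0 ?mul1r ?mulr1.
have pqC x y : p x * q y = q y * p x.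
  by rewrite /p; case: (x \in _); rewrite ?mul0r ?mulr0 ?mul1r ?mulr1.
have qC x y : q x * q y = - (q y * q x).
  by rewrite /q; case: ifP => _; case: ifP => _; rewrite ?mul0r ?mulr0 ?oppr0 //;
    apply: generatorC.
have := idf (fun i => p i + q i); rewrite eval_mono //.
have inE_t (i : 'I_n) : (val i \in map val t) = (i \in t).
  by rewrite mem_map //; apply: val_inj.
have disj i : i \in u -> i \notin t.
  have : uniq (t ++ u) by rewrite (perm_uniq tu) enum_uniq.
  by rewrite cat_uniq => /and3P[_ /hasPn h _] /h.
rewrite -(expand_perm _ _ _ Ac tu) //.
rewrite expand_extract; first last.
- by move=> x /disj xt; rewrite /p /q inE_t (negPf xt).
- by move=> x xt; rewrite /p inE_t xt.
rewrite (_ : \prod_(x <- t) _ = \prod_(i <- map val t) generator R i).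
  move/generator_prod_torsion => h; apply: char_dvd; apply: h.
  by rewrite (map_inj_uniq val_inj).
by rewrite big_map; apply: eq_big_seq => i it; rewrite /q inE_t it.
Qed.
End Identities.

(** * The chain of submodules *)

Lemma sq_pi_eq0 (A : pzRingType) (V : lmodType A) (M N : submodClosed V)
  (u : submod_type M) : (\pi_(subquot M N) u == 0) = (val u \in N).
Proof.
have pi0 : \pi_(subquot M N) (0 : submod_type M) = 0.
  by apply: (addrI (\pi_(subquot M N) (0 : submod_type M))); rewrite -sq_piD !addr0.
rewrite -pi0 -(Quotient.idealrBE (submod_meet N : zmodClosed (submod_type M))).
by rewrite subr0.
Qed.

(** First isomorphism theorem for a linear relation in place of a linear map, for
    maps that are specified by a congruence rather than by a formula. The relation
    is functional modulo [M0] by linearity and the description of the kernel. *)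
Lemma lmod_iso_relation (A : pzRingType) (U W : lmodType A) (M1 M0 : submodClosed U)
    (rel : U -> W -> Prop) :
    (forall x, x \in M1 -> exists w, rel x w) ->
    (forall w, exists2 x, x \in M1 & rel x w) ->
    (forall a x x' w w', rel x w -> rel x' w' -> rel (a *: x + x') (a *: w + w')) ->
    (forall x w, x \in M1 -> rel x w -> (x \in M0) <-> (w = 0)) ->
  lmod_iso (subquot M1 M0) W.
Proof.
move=> total surj lin ker.
have mem (x : submod_type M1) : val x \in M1 by apply: valP.
have relB x x' w w' : rel x w -> rel x' w' -> rel (x - x') (w - w').
  by move=> r r'; have := lin (-1) _ _ _ _ r' r; rewrite !scaleN1r ![- _ + _]addrC.
have cong (x x' : submod_type M1) w w' : rel (val x) w -> rel (val x') w' ->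
    (\pi_(subquot M1 M0) x = \pi x') <-> (w = w').
  move=> r r'; have piE : (\pi_(subquot M1 M0) x == \pi x') = (val x - val x' \in M0).
    by rewrite -raddfB -(Quotient.idealrBE (submod_meet M0 : zmodClosed (submod_type M1))).
  have xx' : val x - val x' \in M1 by rewrite -raddfB; apply: valP.
  have [to0 of0] := ker _ _ xx' (relB _ _ _ _ r r').
  split=> [/eqP|ww]; first by rewrite piE => /to0/eqP; rewrite subr_eq0 => /eqP.
  by apply/eqP; rewrite piE of0 // ww subrr.
have /choice[phi phiE] : forall x : subquot M1 M0, exists w, rel (val (repr x)) w.
  by move=> x; apply: total; apply: mem.
have phi_pi x w : rel (val x) w -> phi (\pi x) = w.
  by move=> r; apply/(cong _ _ _ _ (phiE _) r); rewrite reprK.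
have phi_lin : linear phi.
  move=> a x y; rewrite -[x in LHS]reprK -[y in LHS]reprK.
  rewrite (_ : _ + _ = \pi_(subquot M1 M0) (a *: repr x + repr y)).
    by apply: phi_pi; rewrite linearP; apply: lin; apply: phiE.
  by rewrite sq_piD sq_piZ.
pose phiL := GRing.isLinear.Build A (subquot M1 M0) W _ phi phi_lin.
pose phi' : {linear subquot M1 M0 -> W} := HB.pack phi phiL.
have psiP w : exists x : subquot M1 M0, phi x = w.
  have [x M1x r] := surj w; pose u : submod_type M1 := exist _ x M1x.
  by exists (\pi u); apply: phi_pi.
have [psi psiE] := choice psiP.
exists phi'; exists psi => // x /=.
have := phiE (psi (phi x)); rewrite psiE => r.
by rewrite -[LHS]reprK -[RHS]reprK; apply/(cong _ _ _ _ r (phiE x)).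
Qed.

Section Residues.
Variables (R : comPzRingType) (l n : nat).
Hypothesis charR : is_char R l.
Hypothesis n_gt0 : (0 < n)%N.

Definition multilinear (c : ZS n) : permZX n :=
  \sum_(s : 'S_n) << c s *g mono_word s >>.

Lemma multilinearD c d : multilinear (c + d) = multilinear c + multilinear d.
Proof.
rewrite /multilinear -big_split; apply: eq_bigr => s _ /=.
by rewrite ffunE monalgUD.
Qed.

Lemma multilinearZ (a c : ZS n) : multilinear (a * c) = a *: multilinear c.
Proof.
rewrite [RHS]/(ZX_scale a _) /ZX_scale /multilinear.
transitivity (\sum_(u : 'S_n) \sum_(s : 'S_n)
    (<< a s * c (u * s^-1)%g *g mono_word u >> : ZX)).
  by apply: eq_bigr => u _; rewrite zs_mulE raddf_sum.
rewrite exchange_big /=; apply: eq_bigr => s _.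
rewrite raddf_sum /= mulrz_suml (reindex_inj (mulIg s)) /=; apply: eq_bigr => t _.
rewrite mulgK perm_act_mono mulrC -mulrzz.
exact: raddfMz.
Qed.

Lemma multilinear_Pn c : multilinear c \in Pn n.
Proof. by apply/asboolP; exists c. Qed.

(** Presents the quotient of P_n by its identities as a quotient of the group
    ring. *)
Definition residue (c : ZS n) : PnId R n :=
  \pi_(subquot (Pn n) (Id (grassmann R) n))
    (Sub (multilinear c) (multilinear_Pn c) : submod_type (Pn n)).

Lemma residue_surj x : exists c, x = residue c.
Proof.
have [u ->] := sq_surj x; have /asboolP[c uE] := valP u.
exists (finfun c); congr (\pi _); apply: val_inj; rewrite SubK [LHS]uE.
by apply: eq_bigr => s _; rewrite ffunE.
Qed.

Lemma residue_lin (a c d : ZS n) : residue (a * c + d) = a *: residue c + residue d.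
Proof.
rewrite /residue -[a *: _]sq_piZ -sq_piD; congr (\pi _); apply: val_inj.
by rewrite linearP !SubK /= multilinearD multilinearZ.
Qed.

Lemma residue_eq0 c : residue c = 0 <-> vanish_below l n c.
Proof.
have [idl lid] := Id_grassmannP charR c n_gt0.
have [vl lv] := vanish_belowP l (Ordinal n_gt0) c.
split=> [/eqP|vc]; first by rewrite sq_pi_eq0 SubK => /idl.
by apply/eqP; rewrite sq_pi_eq0 SubK; apply/lid/vl.
Qed.
End Residues.

Section Chain.
Variables (R : comPzRingType) (l n : nat).
Hypothesis charR : is_char R l.
Hypothesis l_odd : odd l \/ l = 0%N.
Hypothesis n_gt0 : (0 < n)%N.

Lemma vanish_below_lin k (a c d : ZS n) : vanish_below l k c -> vanish_below l k d ->
  vanish_below l k (a * c + d).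
Proof.
move=> vc vd j t jk tj; rewrite -[a * c]mulr1z level_symbol_lin mul1r level_symbolM.
apply: dvdzD; last exact: vd.
by apply: rpred_sum => s _; apply/dvdz_mull/vc => //; rewrite size_map.
Qed.

Lemma vanish_below0 k : vanish_below l k (0 : ZS n).
Proof.
move=> j t _ _; rewrite -[X in symbol X](mul0r (0 : ZS n)) level_symbolM big1 ?dvdz0 //.
by move=> s _; rewrite ffunE mul0r.
Qed.

Definition filtration k : {pred PnId R n} :=
  fun x => `[< exists2 c, x = residue R c & vanish_below l k c >].

Lemma filtration_residue k c : (k <= n)%N ->
  (residue R c \in filtration k) <-> vanish_below l k c.
Proof.
move=> kn; split=> [/asboolP[d dc vd]|vc]; last by apply/asboolP; exists c.
have /(residue_eq0 charR n_gt0) v0 : residue R ((-1) * d + c) = 0.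
  by rewrite residue_lin -dc scaleN1r addNr.
have -> : c = 1 * d + ((-1) * d + c) by rewrite mul1r mulN1r addNKr.
apply: vanish_below_lin => // j t jk tj; apply: v0 => //; exact: leq_trans kn.
Qed.

Lemma spread_level_lin u k (a c d : ZS n) :
  spread u (level k (symbol (a * c + d))) =
  a * spread u (level k (symbol c)) + spread u (level k (symbol d)).
Proof.
rewrite spreadM; apply/ffunP => s; rewrite !ffunE -[a * c]mulr1z.
by rewrite level_symbol_lin mul1r level_symbolM.
Qed.

Lemma filtration_closed k : subsemimod_closed (filtration k).
Proof.
have lin a x y : x \in filtration k -> y \in filtration k -> a *: x + y \in filtration k.
  move=> /asboolP[c -> vc] /asboolP[d -> vd]; apply/asboolP.
  by exists (a * c + d); [rewrite residue_lin | apply: vanish_below_lin].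
have z0 : 0 \in filtration k.
  apply/asboolP; exists 0; last exact: vanish_below0.
  exact/esym/(residue_eq0 charR n_gt0)/vanish_below0.
split; first split=> // x y Fx Fy; first by rewrite -[x]scale1r lin.
by move=> a x Fx; rewrite -[_ *: _]addr0 lin.
Qed.
HB.instance Definition _ k := GRing.isSubmodClosed.Build (ZS n) (PnId R n)
  (filtration k) (filtration_closed k).

Definition filtration_step k : submodClosed (PnId R n) := filtration k.

(** The map onto the factor of level [k] divides the symbol by the power of 2 that
    it contains; the quotient is well defined modulo [l], which is odd or 0. *)
Definition factor_rel k (T : tableau n (hook n k)) (leg : seq 'I_n)
    (x : PnId R n) (w : specht_mod T l) : Prop :=
  exists c (y : submod_type (specht T)), [/\ x = residue R c, vanish_below l k c,
    w = \pi_(specht_mod T l) y &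
    forall s, (l%:Z %| spread leg (level k (symbol c)) s - 2 ^+ uphalf k * val y s)%Z].

(** The relation is total by [level_structure] and onto by [level_realizes]. Its
    kernel is correct for two reasons: powers of 2 can be cancelled modulo [l], and an
    element of the Specht module that is divisible by [l] in the group ring is [l]
    times an element of the Specht module, by [boundary_divides]. *)
Lemma filtration_factor k (T : tableau n (hook n k)) : (k < n)%N ->
  lmod_iso (subquot (filtration_step k) (filtration_step k.+1)) (specht_mod T l).
Proof.
move=> kn; have [leg [sleg uleg spE]] := spechtP T kn.
apply: (@lmod_iso_relation _ _ _ _ _ (factor_rel leg)).
- move=> _ /asboolP[c -> vc].
  have [h [h' [Ah Ah' hE]]] := level_structure (Ordinal n_gt0) l_odd vc.
  have yS : spread leg (boundary h) \in specht T by apply/spE; exists h.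
  pose y : submod_type (specht T) := exist _ (spread leg (boundary h)) yS.
  exists (\pi_(specht_mod T l) y), c, y; split=> // s.
  by rewrite !ffunE hE ?size_map // addrC addKr dvdz_mulr.
- move=> w; have [y ->] := sq_surj w.
  have /spE[h Ah yE] := valP y; have [c vc cE] := level_realizes k Ah.
  have vlc : vanish_below l k c.
    by move=> j t jk tj; have := vc j t jk tj; rewrite dvd0z => /eqP ->; apply: dvdz0.
  exists (residue R c); first by apply/asboolP; exists c.
  exists c, y; split=> // s.
  by rewrite yE !ffunE cE ?size_map // subrr dvdz0.
- move=> a x x' w w' [c [y [-> vc -> cy]]] [d [z [-> vd -> dz]]].
  exists (a * c + d), (a *: y + z); split.
  + by rewrite residue_lin.
  + exact: vanish_below_lin.
  + by rewrite sq_piD sq_piZ.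
  move=> s; rewrite linearP spread_level_lin.
  rewrite [X in _ - _ * X]ffunE [X in X - _]ffunE [X in _ - _ * (X + _)]zs_mulE zs_mulE.
  rewrite mulrDr opprD addrACA mulr_sumr -sumrB; apply: dvdzD; last exact: dz.
  apply: rpred_sum => v _; rewrite mulrCA -mulrBr; exact/dvdz_mull/cy.
move=> x w Fx [c [y [-> vc -> cy]]].
have [toV ofV] := filtration_residue c kn.
have /spE[h Ah yE] := valP y; have Abh := boundary_alternating Ah.
have lAc : alternating (level k (symbol c)).
  by rewrite /level; case: odd; [apply: boundary_alternating|]; apply: symbol_alternating.
split=> [/toV vc'|/eqP].
  apply/eqP; rewrite sq_pi_eq0.
  have ybh t : size t = k -> (l%:Z %| boundary h t)%Z.
    rewrite -sleg; apply: spread_dvd => // s; apply: (dvdz_pow2 (p := uphalf k)) => //.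
    rewrite -yE -[_ * _](subKr (spread leg (level k (symbol c)) s)).
    by apply: dvdzB => //; rewrite ffunE vc' ?size_map ?ltnSn.
  have [h' Ah' h'E] := boundary_divides (Ordinal n_gt0) Ah ybh.
  apply/asboolP; exists (spread leg (boundary h')); first by apply/spE; exists h'.
  rewrite yE; apply/ffunP => s.
  by rewrite ffunMnE !ffunE h'E ?size_map // mulrC -mulr_natr natz.
rewrite sq_pi_eq0 => /asboolP[z _ yz]; apply: ofV => j t.
rewrite ltnS leq_eqVlt => /orP[/eqP -> tk|jk tj]; last exact: vc tj.
apply: (spread_dvd lAc uleg) => [s|]; last by rewrite sleg.
rewrite -[X in (_ %| X)%Z](subrK (2 ^+ uphalf k * val y s)); apply: dvdzD => //.
by apply: dvdz_mull; rewrite yz ffunMnE -mulr_natr natz dvdz_mull.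
Qed.
End Chain.

Theorem theorem10 (R : comPzRingType) (l : nat) (charR : is_char R l)
  (odd_or_0 : odd l \/ l = 0%N) (n : nat) (n_gt0 : (0 < n)%N)
  (T : forall k : 'I_n, tableau n (hook n k)) :
  exists (M : nat -> submodClosed (PnId R n)) (s : 'S_n),
    [/\ M 0%N =i pred1 0, M n =i predT
      & forall i : 'I_n, {subset M i <= M i.+1} /\
          lmod_iso (subquot (M i.+1) (M i)) (specht_mod (T (s i)) l)].
Proof.
exists (fun i => filtration_step charR n_gt0 (n - i)).
exists (perm (@rev_ord_inj n)); split.
- move=> x; rewrite subn0; have [c ->] := residue_surj x.
  apply/idP/eqP => [/(filtration_residue charR n_gt0 c (leqnn n))|].
    exact: (residue_eq0 charR n_gt0 c).2.
  by move/(residue_eq0 charR n_gt0 c)/(filtration_residue charR n_gt0 c (leqnn n)).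
- move=> x; rewrite subnn; have [c ->] := residue_surj x.
  by apply/asboolP; exists c => // j.
move=> i; split=> [x /asboolP[c -> vc]|].
  by apply/asboolP; exists c => // j t jk; apply: vc; rewrite (leq_trans jk) // leq_sub.
(* Step i adds level n - 1 - i, so the levels occur in decreasing order. *)
rewrite permE; have -> : (n - i)%N = (rev_ord i).+1 by rewrite /= subnSK.
exact: (filtration_factor charR odd_or_0 n_gt0 (T (rev_ord i)) (ltn_ord (rev_ord i))).
Qed.
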